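(* Let either $0<\beta<1$ and $h\in\mathbb R$, or $\beta\ge1$ and $h\ne0$. Let $\Sigma=(\sigma_1,\ldots,\sigma_n)\in\{-1,1\}^n$ have the Curie--Weiss distribution with inverse temperature $\beta$ and external field $h$, and let $S=\sum_{i=1}^n\sigma_i$. Let $m_0$ be the unique solution of $m=\tanh(\beta(m+h))$ such that $m_0h\ge0$. Define $$W=\frac{S-nm_0}{\sigma},\qquad \sigma^2=\frac{n(1-m_0^2)}{1-(1-m_0^2)\beta}.$$ Then $$\frac{P(W\ge x)}{1-\Phi(x)}=1+O(1)(1+x^3)/\sqrt n$$ for $0\le x\le n^{1/6}$.
   Context: $\Phi$ is the standard normal distribution function. The Curie--Weiss distribution of $n$ spins $(\sigma_1,\ldots,\sigma_n)\in\{-1,1\}^n$ assigns to each configuration the probability $$Z_{\beta,h}^{-1}\exp\Bigl(\frac\beta n\sum_{1\le i<j\le n}\sigma_i\sigma_j+\beta h\sum_{i=1}^n\sigma_i\Bigr),$$ where $Z_{\beta,h}$ is the normalizing constant. In the stated parameter range $1-(1-m_0^2)\beta>0$, so $\sigma^2$ is well defined. $O(1)$ denotes a quantity whose absolute value is bounded by a constant not depending on $n$ and $x$ (it may depend on $\beta,h$). *)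

(* Defs.v *)
From mathcomp Require Import all_boot all_order all_algebra.
From mathcomp Require Import all_classical all_reals all_analysis.

Set Implicit Arguments.
Unset Strict Implicit.
Unset Printing Implicit Defensive.

Import Order.TTheory GRing.Theory Num.Theory.

Local Open Scope ring_scope.

Definition Phi (R : realType) (x : R) : R :=
  fine (normal_prob (0 : R) 1 `]-oo, x]%classic).

Definition tanh (R : realType) (x : R) : R :=
  (expR x - expR (- x)) / (expR x + expR (- x)).

(* A configuration of {-1, 1}^n is encoded by booleans: true for the spin +1,
   false for the spin -1. *)
Definition config (n : nat) := {ffun 'I_n -> bool}.

Definition spin (R : realType) (n : nat) (s : config n) (i : 'I_n) : R :=
  if s i then 1 else - 1.

Definition total_spin (R : realType) (n : nat) (s : config n) : R :=
  \sum_(i < n) spin R s i.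

Definition CW_weight (R : realType) (beta h : R) (n : nat) (s : config n) : R :=
  expR (beta / n%:R * (\sum_(i < n) \sum_(j < n | (i < j)%N)
                          spin R s i * spin R s j)
        + beta * h * \sum_(i < n) spin R s i).

Definition CW_Z (R : realType) (beta h : R) (n : nat) : R :=
  \sum_(s : config n) CW_weight beta h s.

Definition CW_pmf (R : realType) (beta h : R) (n : nat) (s : config n) : R :=
  (CW_Z beta h n)^-1 * CW_weight beta h s.

Definition CW_prob (R : realType) (beta h : R) (n : nat)
    (E : pred (config n)) : R :=
  \sum_(s : config n | E s) CW_pmf beta h s.

Definition CW_sigma2 (R : realType) (beta m0 : R) (n : nat) : R :=
  n%:R * (1 - m0 ^+ 2) / (1 - (1 - m0 ^+ 2) * beta).

Definition CW_W (R : realType) (beta m0 : R) (n : nat) (s : config n) : R :=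
  (total_spin R s - n%:R * m0) / Num.sqrt (CW_sigma2 beta m0 n).

(* Main.v *)
Require Import Defs.
From mathcomp Require Import all_boot all_order all_algebra.
From mathcomp Require Import all_classical all_reals all_analysis.
From mathcomp Require Import measurable_realfun.
From mathcomp Require Import zify ring lra.

(** Under the Curie-Weiss distribution the number [k] of up spins has an
explicit law, [spin_weight], and the whole argument compares this law with the
Gaussian density, one lattice point at a time.

Put [m = (2k - n)/n]. The logarithm of the ratio of two consecutive weights is,
up to [O(1/n)], [2 beta (m + h) - log_odds m], which vanishes at [m = m0]
because [m0 = tanh (beta (m0 + h))] and has slope [- curvature beta m0] there,
where [curvature] is positive. Two consequences are drawn.

Near [m0] ([spin_weight_gaussian]): summing the increments from a lattice point
[l] adjacent to [n m0], the weight at distance [w] standard deviations is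
[spin_weight l * exp (- w^2/2)], with a relative error
[O((1 + |w|^3)/sqrt n)] as long as [w = O(n^(1/6))]: there are
[O(1 + |w| sqrt n)] increments, each with error [O((1 + w^2)/n)].

Everywhere ([dominating_site_exists]): the weight is at most
[C * spin_weight l * exp (- c (2k - n - n m0)^2/n)]. For [h >= 0] and
[2k >= n] this follows from the concavity of [- log_odds] on the positive side;
the points with [2k < n], where a second local maximum may exist, are handled by
the reflection [k -> n - k], which costs a factor [exp (2 beta h (2k - n))].
The case [h < 0] follows by the global spin flip.

These two facts suffice for an abstract comparison ([lattice_tail]) of the sum
of the weights over [w >= x] with [K (1 - Phi x)], where the constant [K] does
not depend on [x]: each weight is compared with the Gaussian mass of a lattice
cell, the cubic errors are summed by a telescoping potential, and everything
beyond [B n^(1/6)] is negligible against [1 - Phi x] for [x <= n^(1/6)].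
Applying it to the two orientations of the chain at [x = 0] shows that the
normalizing sum is [K (1 + O(1/sqrt n))] ([spin_weight_total]), so that [K]
cancels in the probability. Finitely many values of [n] are absorbed in the
constant.

Throughout, [y] stands for [n^(1/6)], so that [sqrt n = y^3], and the standard
deviation is [s * y^3] with [s^2 = 2 / curvature beta m0]. *)

Import Order.TTheory GRing.Theory Num.Theory.
Import numFieldNormedType.Exports.
Local Open Scope ring_scope.

(** * The normal distribution *)

Definition gauss {R : realType} (x : R) : R := expR (- (x ^+ 2 / 2)).

Lemma gauss_gt0 {R : realType} (x : R) : 0 < gauss x.
Proof. exact: expR_gt0. Qed.

Definition gaussian_mass (R : realType) : R := Num.sqrt (2 * pi).

Lemma gaussian_mass_gt0 (R : realType) : 0 < gaussian_mass R.
Proof. by rewrite sqrtr_gt0 mulr_gt0// pi_gt0. Qed.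

Lemma normal_pdfE01 (R : realType) (x : R) :
  normal_pdf 0 1 x = gauss x / gaussian_mass R.
Proof.
rewrite normal_pdfE ?oner_neq0// mulrC /normal_fun /normal_peak /gauss.
rewrite /gaussian_mass expr1n mul1r subr0 mulNr; congr (_ * (Num.sqrt _)^-1).
by rewrite mulr2n mulrDl mul1r.
Qed.

Lemma gauss_nincr {R : realType} (u v : R) : 0 <= u -> u <= v -> gauss v <= gauss u.
Proof.
move=> u0 uv; rewrite ler_expR lerN2 ler_pM2r ?invr_gt0//.
by rewrite ler_sqr// nnegrE// (le_trans u0).
Qed.

Lemma PhiB (R : realType) (u v : R) : u <= v ->
  ((Phi v - Phi u)%:E =
   \int[lebesgue_measure]_(z in `]u, v]%classic) (normal_pdf 0 1 z)%:E)%E.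
Proof.
move=> uv; rewrite EFinB /Phi !fineK ?fin_num_measure//.
have mi (i : interval R) : measurable [set` i] by exact: measurable_itv.
rewrite -[RHS]/(normal_prob 0 1 `]u, v]%classic).
have -> : (`]-oo, v]%classic = `]-oo, u]%classic `|` `]u, v]%classic)%classic.
  by rewrite -itv_bndbnd_setU.
rewrite measureU//; last first.
  apply/seteqP; split=> [z|//]; rewrite /= !in_itv/= => -[zu /andP[uz _]].
  by move: (le_lt_trans zu uz); rewrite ltxx.
by rewrite addeAC subee ?add0e// fin_num_measure.
Qed.

Lemma Phi_increment_bounds (R : realType) (u v : R) : 0 <= u -> u <= v ->
  (v - u) * (gauss v / gaussian_mass R) <= Phi v - Phi u
    <= (v - u) * (gauss u / gaussian_mass R).
Proof.
move=> u0 uv.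
have g0 := gaussian_mass_gt0 R.
have cstE (c : R) :
    (\int[lebesgue_measure]_(z in `]u, v]%classic) c%:E = ((v - u) * c)%:E)%E.
  rewrite integral_cst//= lebesgue_measure_itv/= lte_fin.
  case: ltP => [_|vu]; first by rewrite -EFinB -EFinM mulrC.
  have -> : v = u by apply/eqP; rewrite eq_le vu uv.
  by rewrite subrr mul0r mule0.
rewrite -!lee_fin PhiB// -!cstE; apply/andP; split.
  apply: ge0_le_integral => //=.
  - by move=> z _; rewrite lee_fin divr_ge0 ?ltW// gauss_gt0.
  - by apply/measurable_EFinP/measurable_funTS; exact: measurable_normal_pdf.
  - move=> z; rewrite in_itv/= => /andP[uz zv].
    rewrite lee_fin normal_pdfE01 ler_pM2r ?invr_gt0//.
    by apply: gauss_nincr => //; rewrite (le_trans u0)// ltW.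
apply: ge0_le_integral => //=.
- by move=> z _; rewrite lee_fin normal_pdf_ge0.
- by apply/measurable_EFinP/measurable_funTS; exact: measurable_normal_pdf.
- move=> z; rewrite in_itv/= => /andP[uz zv].
  rewrite lee_fin normal_pdfE01 ler_pM2r ?invr_gt0//.
  by apply: gauss_nincr => //; rewrite ltW.
Qed.

Lemma Phi_le1 (R : realType) (x : R) : Phi x <= 1.
Proof.
by rewrite -lee_fin /Phi fineK ?fin_num_measure//; exact: probability_le1.
Qed.

Lemma Phi_cvg1 (R : realType) (x e : R) : 0 < e ->
  exists2 z, x <= z & 1 - Phi z <= e.
Proof.
move=> e0.
have cvgP : ((fun n => normal_prob (0 : R)%R 1%R `]-oo, n%:R])
    @ \oo --> (1 : R)%:E)%classic.
  rewrite -[X in (_ --> X)%classic](probability_setT (normal_prob (0 : R)%R 1%R)).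
  have <- : (\bigcup_n `]-oo, n%:R] = [set: R])%classic.
    rewrite -subTset => t _ /=.
    by exists (Num.truncn t).+1; rewrite //= in_itv/= ltW// truncnS_gt.
  apply: nondecreasing_cvg_mu => //; first exact: bigcup_measurable.
  move=> n m nm; apply/subsetPset => z/=; rewrite !in_itv/= => /le_trans.
  by apply; rewrite ler_nat.
have cvgF : ((fun n => Phi (n%:R : R)) @ \oo --> (1 : R))%classic.
  exact: fine_cvg cvgP.
move/cvgrPdist_le : cvgF => /(_ e e0) [N _ nearF].
have [M _ xM] := nbhs_infty_ger x.
exists (maxn N M)%:R; first by apply: xM => /=; rewrite leq_maxr.
by have := nearF (maxn N M); rewrite /= leq_maxl => /(_ isT) /(le_trans (ler_norm _)).
Qed.

Lemma Phi0 (R : realType) : Phi (0 : R) = 2^-1.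
Proof.
have even : @normal_pdf R 0 1 =1 normal_pdf 0 1 \o -%R.
  by move=> x /=; rewrite !normal_pdfE01 /gauss sqrrN.
have := ge0_symfun_integralT (@normal_pdf_ge0 R 0 1)
  (@continuous_normal_pdf R 0 1 (oner_neq0 R)) even.
rewrite integral_normal_pdf -set_itvcy => half.
have : normal_prob (0 : R)%R 1%R [set: R] =
    (normal_prob (0 : R)%R 1%R `]-oo, (0 : R)%R]%classic
     + normal_prob (0 : R)%R 1%R `](0 : R)%R, +oo[%classic)%E.
  rewrite -measureU//; first by rewrite -itv_bndbnd_setU// set_itvNyy.
  apply/seteqP; split=> [z|//]; rewrite /= !in_itv/= andbT => -[z0 z1].
  by move: (le_lt_trans z0 z1); rewrite ltxx.
rewrite probability_setT.
have -> : normal_prob (0 : R)%R 1%R `](0 : R)%R, +oo[%classic =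
    normal_prob (0 : R)%R 1%R `[(0 : R)%R, +oo[%classic.
  rewrite /normal_prob integral_itv_obnd_cbnd//.
  by apply/measurable_EFinP/measurable_funTS; exact: measurable_normal_pdf.
rewrite /Phi.
have /fineK E : normal_prob (0 : R)%R 1%R `[(0 : R)%R, +oo[%classic \is a fin_num
  by rewrite fin_num_measure.
move: half; rewrite -[X in (_ * X)%E]/(normal_prob (0 : R)%R 1%R `[(0 : R)%R, +oo[%classic).
rewrite -E -EFinM => -[half].
have /fineK <- : normal_prob (0 : R)%R 1%R `]-oo, (0 : R)%R]%classic \is a fin_num
  by rewrite fin_num_measure.
by rewrite -EFinD => -[] /=; lra.
Qed.

Lemma expRN_le_inv {R : realType} (t : R) : 0 <= t -> expR (- t) <= (1 + t)^-1.
Proof.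
move=> t0; rewrite expRN lef_pV2 ?posrE ?expR_gt0 ?expR_ge1Dx//.
by rewrite ltr_wpDr.
Qed.

Lemma gaussD {R : realType} (u d : R) :
  gauss (u + d) = gauss u * expR (- (u * d + d ^+ 2 / 2)).
Proof. by rewrite /gauss -expRD; congr expR; lra. Qed.

Lemma Phi_nondecreasing (R : realType) (u v : R) : 0 <= u -> u <= v -> Phi u <= Phi v.
Proof.
move=> u0 uv; have /andP[+ _] := Phi_increment_bounds R u v u0 uv.
rewrite -[Phi u <= _]subr_ge0; apply: le_trans.
by rewrite mulr_ge0 ?subr_ge0// divr_ge0// ltW// ?gauss_gt0 ?gaussian_mass_gt0.
Qed.

(** For [v >= 1] one has [gauss (v + 1) <= gauss v / 2], so the density summed
over unit cells is dominated by a geometric series. *)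
Lemma gauss_tail_le (R : realType) (u : R) : 1 <= u ->
  1 - Phi u <= 2 * (gauss u / gaussian_mass R).
Proof.
move=> u1; set M := gaussian_mass R.
have M0 : 0 < M by exact: gaussian_mass_gt0.
have step v : 1 <= v ->
    Phi (v + 1) + 2 * (gauss (v + 1) / M) <= Phi v + 2 * (gauss v / M).
  move=> v1.
  have v0 : 0 <= v by lra.
  have vv : v <= v + 1 by lra.
  have /andP[_] := Phi_increment_bounds R v (v + 1) v0 vv.
  rewrite addrAC subrr add0r mul1r -/M => inc.
  have : gauss (v + 1) / M <= 2^-1 * (gauss v / M).
    rewrite gaussD mulrAC [leRHS]mulrC ler_pM2l ?divr_gt0 ?gauss_gt0//.
    apply: (le_trans (expRN_le_inv _ _)); first lra.
    by rewrite lef_pV2 ?posrE; lra.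
  lra.
have iter N : Phi (u + N%:R) + 2 * (gauss (u + N%:R) / M)
    <= Phi u + 2 * (gauss u / M).
  elim: N => [|N]; first by rewrite addr0.
  apply: le_trans; rewrite -natr1 addrA; apply: step.
  by rewrite ler_wpDr.
apply/ler_addgt0Pr => e e0.
have [z uz Fz] := Phi_cvg1 R u e e0.
have zN : z <= u + (Num.truncn (z - u)).+1%:R.
  by rewrite -lerBlDl ltW// truncnS_gt.
have := iter (Num.truncn (z - u)).+1; set v := u + _ in zN *.
have : Phi z <= Phi v by apply: Phi_nondecreasing => //; lra.
have : 0 <= gauss v / M by rewrite divr_ge0// ltW// gauss_gt0.
lra.
Qed.

(** The mass of the single cell [[x, x + 1/(2 (1 + x))]], on which the density
loses at most a constant factor, already gives this Mills-type bound. *)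
Lemma gauss_tail_ge (R : realType) (x : R) : 0 <= x ->
  gauss x <= 6 * (1 + x) * gaussian_mass R * (1 - Phi x).
Proof.
move=> x0; set M := gaussian_mass R.
have M0 : 0 < M by exact: gaussian_mass_gt0.
pose d := (2 * (1 + x))^-1.
have d0 : 0 < d by rewrite invr_gt0; lra.
have dE : d * (2 * (1 + x)) = 1 by rewrite mulVf// gt_eqF//; lra.
have d12 : d <= 2^-1 by rewrite lef_pV2 ?posrE; lra.
have xd : x <= x + d by lra.
have /andP[+ _] := Phi_increment_bounds R x (x + d) x0 xd.
have -> : x + d - x = d by ring.
rewrite -/M gaussD => inc.
have e38 : 3 / 8 <= expR (- (x * d + d ^+ 2 / 2)).
  apply: le_trans (expR_ge1Dx _).
  suff : d ^+ 2 <= 1 / 4 by lra.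
  by rewrite expr2; nra.
have {}inc : d * (gauss x * (3 / 8)) <= (1 - Phi x) * M.
  rewrite -ler_pdivrMr//.
  have := Phi_le1 R (x + d).
  have : d * (gauss x * (3 / 8)) / M <= d * (gauss x * expR (- (x * d + d ^+ 2 / 2)) / M).
    rewrite -[leLHS]mulrA ler_pM2l// ler_pM2r ?invr_gt0//.
    by rewrite ler_pM2l// gauss_gt0.
  lra.
have : (d * (2 * (1 + x))) * (gauss x * (3 / 8)) <= (2 * (1 + x)) * ((1 - Phi x) * M).
  rewrite [X in X * _ <= _]mulrC -[leLHS]mulrA ler_pM2l//; lra.
rewrite dE.
have : 0 <= (2 * (1 + x)) * ((1 - Phi x) * M).
  by rewrite mulr_ge0 ?mulr_ge0 ?subr_ge0 ?Phi_le1//; lra.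
lra.
Qed.

(** The quadratic factor [p] is chosen so that [- (p * gauss)' = (u^3 - u^2 + 2 u + 1) * gauss],
which dominates [(1 + u^3) * gauss / 2] for all [u >= 0]. A sum of cubic errors
against the Gaussian then telescopes, and its total is of the order
[(1 + x^2) * gauss x], that is [(1 + x^3) * (1 - Phi x)]. *)
Definition gauss_potential {R : realType} (u : R) : R := (u ^+ 2 - u + 4) * gauss u.

Lemma gauss_potential_ge0 {R : realType} (u : R) : 0 <= gauss_potential u.
Proof.
rewrite mulr_ge0 ?ltW ?gauss_gt0//.
have := sqr_ge0 (u - 2^-1); lra.
Qed.

(** Bounding [exp (- t)] by [1 / (1 + t)] turns the discrete derivative
into a polynomial inequality. *)
Lemma gauss_potential_step {R : realType} (u d : R) :
  0 <= u -> 0 < d -> u * d + d ^+ 2 / 2 <= 1 ->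
  d * gauss u * (1 + u ^+ 3) <= 4 * (gauss_potential u - gauss_potential (u + d)).
Proof.
move=> u0 d0; rewrite /gauss_potential gaussD; set t := u * d + _ => t1.
have t0 : 0 <= t by rewrite addr_ge0 ?mulr_ge0// ltW.
have p0 : 0 <= (u + d) ^+ 2 - (u + d) + 4.
  have := sqr_ge0 (u + d - 2^-1); lra.
have := expRN_le_inv t t0; set E := expR _ => Et.
suff H : d * (1 + u ^+ 3) <= 4 * (u ^+ 2 - u + 4 - ((u + d) ^+ 2 - (u + d) + 4) * E).
  have := ler_wpM2l (ltW (gauss_gt0 u)) H; lra.
suff H : d * (1 + u ^+ 3) <= 4 * (u ^+ 2 - u + 4 - ((u + d) ^+ 2 - (u + d) + 4) * (1 + t)^-1).
  have := ler_wpM2l p0 Et; lra.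
have t10 : 0 < 1 + t by lra.
rewrite -(ler_pM2r t10).
have -> : 4 * (u ^+ 2 - u + 4 - ((u + d) ^+ 2 - (u + d) + 4) / (1 + t)) * (1 + t)
  = 4 * ((u ^+ 2 - u + 4) * (1 + t) - ((u + d) ^+ 2 - (u + d) + 4)).
  by field; rewrite gt_eqF.
have cub : 0 <= u ^+ 3 by rewrite exprn_ge0.
have dcub : 0 <= d * (1 + u ^+ 3) by rewrite mulr_ge0; lra.
have : d * (1 + u ^+ 3) * (1 + t) <= d * (1 + u ^+ 3) * 2 by rewrite ler_wpM2l//; lra.
move=> /le_trans; apply.
have -> : 4 * ((u ^+ 2 - u + 4) * (1 + t) - ((u + d) ^+ 2 - (u + d) + 4)) =
  4 * d * (u ^+ 3 - u ^+ 2 + 2 * u + 1 + d * ((u ^+ 2 - u + 2) / 2)).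
  by rewrite /t; field.
rewrite (mulrC 4) -!mulrA ler_pM2l//.
have : 0 <= d * ((u ^+ 2 - u + 2) / 2).
  rewrite mulr_ge0 ?(ltW d0)//; have := sqr_ge0 (u - 2^-1); lra.
have : 0 <= u * ((u - 1) ^+ 2 + 3) by rewrite mulr_ge0// addr_ge0// sqr_ge0.
lra.
Qed.

(** Every contribution from beyond a large multiple of [y] is of size
[exp (- 3 y^2 / 2)] times a power of [y]; since [gauss x >= exp (- y^2 / 2)],
a factor [exp (- y^2)] is left to absorb the power. *)
Lemma gauss_tail_poly (R : realType) (x y : R) : 0 <= x -> x <= y -> 1 <= y ->
  expR (- (3 / 2 * y ^+ 2)) <= 288 * gaussian_mass R * (1 - Phi x) / y ^+ 7.
Proof.
move=> x0 xy y1; set M := gaussian_mass R.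
have M0 : 0 < M by exact: gaussian_mass_gt0.
have y0 : 0 < y by lra.
have F0 : 0 <= 1 - Phi x by rewrite subr_ge0 Phi_le1.
have -> : - (3 / 2 * y ^+ 2) = - (y ^+ 2 / 2) + - (y ^+ 2) by lra.
rewrite expRD.
have e8 : expR (- (y ^+ 2)) <= 24 / y ^+ 8.
  rewrite expRN -[leRHS]invf_div lef_pV2 ?posrE ?expR_gt0 ?divr_gt0 ?exprn_gt0//.
  apply: le_trans (expR_ge1Dxn 3 (sqr_ge0 y)).
  by rewrite -exprM ler_wpDl.
have gxy : gauss y <= gauss x by exact: gauss_nincr.
have gx : gauss x <= 6 * (2 * y) * M * (1 - Phi x).
  apply: (le_trans (gauss_tail_ge R x x0)).
  by rewrite ler_wpM2r// ler_wpM2r ?(ltW M0)//; lra.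
apply: (@le_trans _ _ (gauss x * (24 / y ^+ 8))).
  by apply: ler_pM => //; exact: expR_ge0.
apply: (@le_trans _ _ (6 * (2 * y) * M * (1 - Phi x) * (24 / y ^+ 8))).
  by rewrite ler_wpM2r// divr_ge0// exprn_ge0// ltW.
rewrite le_eqVlt; apply/orP; left; apply/eqP; field.
by rewrite gt_eqF.
Qed.

(** * Comparing a lattice law with the normal tail *)

Lemma first_index_ge {R : realType} (w : nat -> R) (n : nat) (t : R) : t <= w n ->
  exists2 k, (k <= n)%N & t <= w k /\ forall j, (j < k)%N -> w j < t.
Proof.
move=> tn; have ex : exists k, t <= w k by exists n.
case: (ex_minnP ex) => k tk kmin; exists k; first exact: kmin.
by split=> // j jk; rewrite ltNge; apply/negP => /kmin; rewrite leqNgt jk.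
Qed.

Lemma sum_ge_threshold {R : realType} (w a : nat -> R) (n k : nat) (x : R) :
  {homo w : i j / (i <= j)%N >-> i <= j} -> (k <= n)%N -> x <= w k ->
  (forall j, (j < k)%N -> w j < x) ->
  \sum_(j < n | x <= w j) a j = \sum_(k <= j < n) a j.
Proof.
move=> wmon kn xk xlt.
rewrite -(big_mkord (fun j => x <= w j) a) (big_cat_nat (leq0n k) kn)/=.
rewrite big_nat_cond big_pred0 ?add0r; last first.
  by move=> j; case: (ltnP j k) => //= jk; rewrite leNgt xlt.
rewrite big_nat_cond [RHS]big_nat_cond; apply: eq_bigl => j.
by case: (leqP k j) => //= kj; rewrite (le_trans xk (wmon _ _ kj)) !andbT.
Qed.

Lemma linear_le_cubic {R : realType} (x : R) : 0 <= x -> 1 + x <= 2 * (1 + x ^+ 3).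
Proof.
move=> x0.
have : 0 <= (x - 1) ^+ 2 * (x + 1) by rewrite mulr_ge0 ?sqr_ge0//; lra.
have : 0 <= (x - 1) ^+ 2 by rewrite sqr_ge0.
have : 0 <= x ^+ 3 by rewrite exprn_ge0.
lra.
Qed.

(** Within the cell the exponent varies by at most
[u d + d^2/2 <= 2 d (1 + u^3)]. *)
Lemma cell_comparison {R : realType} (u d : R) : 0 <= u -> 0 <= d -> d <= 1 ->
  `|d * gauss u / gaussian_mass R - (Phi (u + d) - Phi u)|
  <= 2 * d * (1 + u ^+ 3) * (d * gauss u / gaussian_mass R).
Proof.
move=> u0 d0 d1; have M0 := gaussian_mass_gt0 R.
have ud : u <= u + d by rewrite lerDl.
have /andP[lo hi] := Phi_increment_bounds R _ _ u0 ud.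
move: lo hi; rewrite [u + d - u]addrC addKr gaussD; set t := u * d + _.
set M := gaussian_mass R in M0 * => lo hi.
have g0 : 0 <= d * gauss u / M.
  by rewrite divr_ge0 ?mulr_ge0 ?(ltW M0) ?(ltW (gauss_gt0 _)).
have t_le : t <= 2 * d * (1 + u ^+ 3).
  have -> : t = d * (u + d / 2) by rewrite /t; field.
  rewrite [2 * d]mulrC -mulrA; apply: ler_wpM2l => //.
  have := linear_le_cubic u u0; have : 0 <= u ^+ 3 by rewrite exprn_ge0.
  lra.
have lo' : d * gauss u / M * (1 - t) <= Phi (u + d) - Phi u.
  apply: le_trans lo.
  have -> : d * (gauss u * expR (- t) / M) = d * gauss u / M * expR (- t) by ring.
  by apply: ler_wpM2l => //; exact: expR_ge1Dx.
have hi' : Phi (u + d) - Phi u <= d * gauss u / M by rewrite -mulrA.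
have := ler_wpM2r g0 t_le.
rewrite ger0_norm ?subr_ge0//; lra.
Qed.

Lemma gauss_le_cubic_tail {R : realType} (x : R) : 0 <= x ->
  gauss x <= 12 * (1 + x ^+ 3) * gaussian_mass R * (1 - Phi x).
Proof.
move=> x0; apply: (le_trans (gauss_tail_ge R x x0)).
have F0 : 0 <= 1 - Phi x by rewrite subr_ge0 Phi_le1.
apply: ler_wpM2r => //; apply: ler_wpM2r; first exact: ltW (gaussian_mass_gt0 R).
have := linear_le_cubic x x0; lra.
Qed.

Lemma gauss_potential_le_tail {R : realType} (x u : R) :
  0 <= x -> x <= u -> u <= x + 1 ->
  gauss_potential u <= 72 * (1 + x ^+ 3) * gaussian_mass R * (1 - Phi x).
Proof.
move=> x0 xu ux1; set M := gaussian_mass R.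
have x30 : 0 <= x ^+ 3 by rewrite exprn_ge0.
have MF0 : 0 <= M * (1 - Phi x).
  by rewrite mulr_ge0 ?subr_ge0 ?Phi_le1 ?(ltW (gaussian_mass_gt0 R)).
rewrite /gauss_potential; apply: (@le_trans _ _ (6 * (1 + x ^+ 2) * gauss x)).
  apply: ler_pM.
  - have := sqr_ge0 (u - 2^-1); lra.
  - exact: ltW (gauss_gt0 _).
  - have : u ^+ 2 <= (x + 1) ^+ 2 by rewrite ler_sqr ?nnegrE; lra.
    have := sqr_ge0 (x - 1); have := sqr_ge0 x; lra.
  - exact: gauss_nincr.
have sq : 0 <= 6 * (1 + x ^+ 2) by have := sqr_ge0 x; lra.
apply: (le_trans (ler_wpM2l sq (gauss_tail_ge R x x0))); rewrite -/M.
have -> : 6 * (1 + x ^+ 2) * (6 * (1 + x) * M * (1 - Phi x)) =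
   36 * (1 + x + x ^+ 2 + x ^+ 3) * (M * (1 - Phi x)) by ring.
rewrite -[leRHS]mulrA; apply: ler_wpM2r => //.
have : 0 <= (x - 1) ^+ 2 * (x + 1) by rewrite mulr_ge0 ?sqr_ge0//; lra.
lra.
Qed.

Lemma lattice_bulk {R : realType} (a w : nat -> R) (d K e : R) (k1 k2 : nat) :
  0 < d -> 0 <= e -> (forall k, w k.+1 = w k + d) -> (k1 <= k2)%N ->
  (forall k, (k1 <= k < k2)%N ->
    [/\ 0 <= w k, w k * d + d ^+ 2 / 2 <= 1 &
      `|a k - K * (Phi (w k.+1) - Phi (w k))|
      <= e * (d * gauss (w k) * (1 + w k ^+ 3))]) ->
  `|\sum_(k1 <= k < k2) a k - K * (Phi (w k2) - Phi (w k1))|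
  <= e * (4 * gauss_potential (w k1)).
Proof.
move=> d0 e0 wS k12 cell.
rewrite -(telescope_sumr (fun k => Phi (w k)) k12) mulr_sumr -sumrB.
apply: (le_trans (ler_norm_sum _ _ _)).
apply: (@le_trans _ _ (\sum_(k1 <= k < k2)
    e * (4 * (gauss_potential (w k) - gauss_potential (w k.+1))))).
  apply: ler_sum_nat => k kk; have [wk0 wkd /le_trans] := cell k kk; apply.
  by rewrite wS; apply: ler_wpM2l => //; exact: gauss_potential_step.
rewrite -mulr_sumr -mulr_sumr; do 2 apply: ler_wpM2l => //.
rewrite -(eq_bigr _ (fun k _ => opprB _ _)) sumrN telescope_sumr// opprB.
by rewrite lerBlDr lerDl gauss_potential_ge0.
Qed.

(** There are at most [n + 1 <= 2 y^6] far points, each with a weight below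
[exp (- 3 y^2 / 2)]. *)
Lemma lattice_far {R : realType} (a w : nat -> R) (n k2 : nat) (A C c t x y : R) :
  0 <= C * A -> 0 <= c -> 0 <= t -> 3 / 2 * y ^+ 2 <= c * t ^+ 2 ->
  n%:R = y ^+ 6 -> 0 <= x -> x <= y -> 1 <= y ->
  (forall k, (k2 <= k <= n)%N ->
    t <= w k /\ 0 <= a k <= C * A * expR (- (c * w k ^+ 2))) ->
  0 <= \sum_(k2 <= k < n.+1) a k
    <= 2 * (C * A) * (288 * gaussian_mass R * (1 - Phi x)) / y.
Proof.
move=> CA c0 t0 ct ny x0 xy y1 bound; apply/andP; split.
  rewrite big_nat_cond; apply: sumr_ge0 => k /andP[kk _].
  by have [_ /andP[]] := bound k kk.
apply: (@le_trans _ _ (\sum_(k2 <= k < n.+1) (C * A * expR (- (3 / 2 * y ^+ 2))))).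
  apply: ler_sum_nat => k kk; have [tw /andP[_ /le_trans]] := bound k kk; apply.
  apply: ler_wpM2l => //; rewrite ler_expR lerN2.
  apply: (le_trans ct); apply: ler_wpM2l => //.
  by rewrite ler_sqr ?nnegrE// (le_trans t0).
rewrite sumr_const_nat -[leLHS]mulr_natr.
have cnt : (n.+1 - k2)%:R <= 2 * y ^+ 6.
  apply: (@le_trans _ _ n.+1%:R); first by rewrite ler_nat leq_subr.
  rewrite -natr1 ny; have := @exprn_ege1 _ 6 y y1; lra.
have E0 := expR_ge0 (- (3 / 2 * y ^+ 2)).
apply: (le_trans (ler_pM (mulr_ge0 CA E0) (ler0n _ _) (lexx _) cnt)).
have y60 : 0 <= 2 * y ^+ 6 by rewrite mulr_ge0 ?exprn_ge0//; lra.
have poly := ler_wpM2r y60 (ler_wpM2l CA (gauss_tail_poly R x y x0 xy y1)).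
apply: (le_trans poly).
rewrite le_eqVlt; apply/orP; left; apply/eqP; field.
by rewrite gt_eqF//; lra.
Qed.

(** The abstract form of the moderate deviation estimate. The weights [a k] sit
at the lattice points [w k] of span [d]; they are Gaussian up to a cubic relative
error in the window [[0, B y]] and have a Gaussian upper bound, with a possibly
worse rate [c], outside. The window is wide enough, [c B^2 >= 3/2], for the
outside to be negligible against [1 - Phi y]. The constants [C] and [Y] depend
on neither [n] nor [x]. *)
Lemma lattice_tail {R : realType} (s B C1 C2 c : R) :
  0 < s -> 3 <= B -> 3 / 2 <= c * B ^+ 2 -> 0 < c -> 0 <= C1 -> 0 <= C2 ->
  exists C Y : R, [/\ 0 <= C, 1 <= Y &
    forall (y : R) (n : nat) (w0 A : R) (a : nat -> R),
    let d := 2 / (s * y ^+ 3) in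
    let w k := w0 + k%:R * d in
    let K := A * gaussian_mass R / d in
    Y <= y -> n%:R = y ^+ 6 -> 0 <= A -> w0 <= 0 -> B * y <= w n ->
    (forall k, (k <= n)%N -> 0 <= w k -> w k <= B * y ->
      `|a k - A * gauss (w k)| <= C1 * A * gauss (w k) * (1 + w k ^+ 3) / y ^+ 3) ->
    (forall k, (k <= n)%N -> 0 <= w k ->
      0 <= a k <= C2 * A * expR (- (c * w k ^+ 2))) ->
    forall x : R, 0 <= x -> x <= y ->
    `|\sum_(k < n.+1 | x <= w k) a k - K * (1 - Phi x)|
      <= C * (K * (1 - Phi x)) * (1 + x ^+ 3) / y ^+ 3].
Proof.
move=> s0 B3 cB c0 C10 C20.
pose q := 2 / s.
have q0 : 0 <= q by rewrite /q divr_ge0// ltW.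
have qB : 0 <= q * (B + 1) by apply: mulr_ge0 => //; lra.
pose N : R := 288.
have N0 : 0 <= N by rewrite /N ler0n.
have NE : N = 288 by [].
exists (N * (C1 + 2 * q) + 12 * q + 2 * N + 2 * N * C2 * q), (1 + q * (B + 1)).
split.
- have t1 : 0 <= N * (C1 + 2 * q) by apply: mulr_ge0 => //; lra.
  have t2 : 0 <= 2 * N * C2 * q by apply: mulr_ge0 => //; apply: mulr_ge0 => //; lra.
  by move: t1 t2 q0 N0; clear; lra.
- by rewrite lerDl.
move=> y n w0 A a d w K Yy ny A0 w00 wn loc glob x x0 xy.
have [y1 y3q] : 1 <= y /\ q * (B + 1) <= y by clear -Yy qB; split; lra.
have y0 : 0 < y by apply: lt_le_trans y1.
have y30 : 0 < y ^+ 3 by rewrite exprn_gt0.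
have dE : d = q / y ^+ 3 by rewrite /d /q invfM mulrA.
have d0 : 0 < d by rewrite /d divr_gt0// mulr_gt0.
have M0 := gaussian_mass_gt0 R; set M := gaussian_mass R in M0 *.
have w0E : w 0 <= 0 by rewrite /w mul0r addr0.
have wS k : w k.+1 = w k + d by rewrite /w -natr1 mulrDl mul1r addrA.
have wmon : {homo w : i j / (i <= j)%N >-> i <= j}.
  by move=> i j ij; rewrite /w lerD2l ler_wpM2r ?(ltW d0)// ler_nat.
have KA : K * d / M = A.
  by rewrite /K divfK ?gt_eqF// mulfK ?gt_eqF.
have K0 : 0 <= K.
  by apply: divr_ge0; [apply: mulr_ge0 => //; exact: ltW|exact: ltW].
clearbody K w d q N.
have yB : y <= B * y by rewrite ler_peMl ?(ltW y0)//; clear -B3; lra.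
(* This makes every cell of the window short enough for
   [gauss_potential_step]. *)
have dB : d * (B * y + 1) <= 1.
  rewrite dE mulrAC ler_pdivrMr// mul1r.
  apply: (@le_trans _ _ (q * ((B + 1) * y))).
    by apply: ler_wpM2l => //; clear -y1; lra.
  rewrite mulrA; apply: (@le_trans _ _ (y * y)).
    by apply: ler_wpM2r => //; exact: ltW.
  by rewrite -expr2 ler_weXn2l.
have d1 : d <= 1.
  have : 0 <= d * (B * y) by rewrite mulr_ge0 ?ltW// (lt_le_trans y0).
  clear -dB; lra.
have F0 : 0 <= 1 - Phi x by rewrite subr_ge0 Phi_le1.
have [k1 k1n [xk1 k1min]] := first_index_ge w n x (le_trans xy (le_trans yB wn)).
have [k2 k2n [Bk2 k2min]] := first_index_ge w n (B * y) wn.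
have k12 : (k1 <= k2)%N.
  rewrite leqNgt; apply/negP => /k1min; apply/negP; rewrite -leNgt.
  exact: le_trans (le_trans xy yB) Bk2.
have wk1 : w k1 <= x + d.
  case: k1 xk1 k1min {k1n k12} => [|k] xk1 k1min.
    by rewrite (le_trans w0E)// addr_ge0// ltW.
  by have := k1min k (ltnSn k); rewrite wS lerD2r; exact: ltW.
rewrite (sum_ge_threshold w a n.+1 k1 x wmon (leqW k1n) xk1 k1min).
rewrite (big_cat_nat k12 (leqW k2n))/=.
set S1 := \sum_(k1 <= i < k2) a i; set S2 := \sum_(k2 <= i < n.+1) a i.
pose E := (1 + x ^+ 3) / y ^+ 3.
have x30 : 0 <= x ^+ 3 by rewrite exprn_ge0.
have yE : (y ^+ 3)^-1 <= E.
  by rewrite -[leLHS]mul1r ler_pM2r ?invr_gt0// lerDl.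
have KF0 := mulr_ge0 K0 F0.
pose e := (C1 + 2 * q) * K / M / y ^+ 3.
have e0 : 0 <= e.
  by rewrite !divr_ge0 ?(ltW M0) ?(ltW y30)// !mulr_ge0 ?addr_ge0 ?mulr_ge0.
have bulk : `|S1 - K * (Phi (w k2) - Phi (w k1))| <= N * (C1 + 2 * q) * (K * (1 - Phi x)) * E.
  have : `|S1 - K * (Phi (w k2) - Phi (w k1))| <= e * (4 * gauss_potential (w k1)).
    apply: (lattice_bulk a w d K e k1 k2) => // k /andP[k1k kk2].
    have wk0 : 0 <= w k := le_trans x0 (le_trans xk1 (wmon _ _ k1k)).
    have wkB : w k <= B * y by rewrite ltW// k2min.
    have kn : (k <= n)%N by rewrite (leq_trans _ k2n)// ltnW.
    split=> //.
      apply: le_trans dB.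
      have : d * w k <= d * (B * y) by rewrite ler_pM2l.
      have : d ^+ 2 <= d * 1 by rewrite expr2 ler_pM2l.
      clear -d0; lra.
    have lock := loc k kn wk0 wkB.
    have inc := ler_wpM2l K0 (cell_comparison _ _ wk0 (ltW d0) d1).
    rewrite -wS -/M -[X in X * `|_|](ger0_norm K0) -normrM mulrBr in inc.
    have AE : K * (d * gauss (w k) / M) = A * gauss (w k) by rewrite -KA; ring.
    rewrite AE in inc.
    have -> : e * (d * gauss (w k) * (1 + w k ^+ 3)) =
        C1 * A * gauss (w k) * (1 + w k ^+ 3) / y ^+ 3 +
        K * (2 * d * (1 + w k ^+ 3) * (d * gauss (w k) / M)).
      by rewrite /e -KA dE; ring.
    apply: le_trans (lerD lock inc); apply: le_trans (ler_normD _ _).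
    by rewrite addrA subrK.
  move=> /le_trans; apply.
  have xw1 : w k1 <= x + 1 by apply: (le_trans wk1); rewrite lerD2l.
  have := gauss_potential_le_tail x (w k1) x0 xk1 xw1; rewrite -/M => pot.
  have e40 : 0 <= e * 4 by rewrite mulr_ge0.
  rewrite mulrA; apply: (le_trans (ler_wpM2l e40 pot)).
  rewrite le_eqVlt; apply/orP; left; apply/eqP.
  by rewrite /e /E NE; field; rewrite !gt_eqF.
have near : 0 <= K * (Phi (w k1) - Phi x) <= 12 * q * (K * (1 - Phi x)) * E.
  rewrite mulr_ge0 ?subr_ge0 ?Phi_nondecreasing//=.
  have /andP[_ hi] := Phi_increment_bounds R x (w k1) x0 xk1.
  have g0 : 0 <= gauss x / M by rewrite divr_ge0// ltW// gauss_gt0.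
  have wd : w k1 - x <= d by rewrite lerBlDl.
  have gM : gauss x / M <= 12 * (1 + x ^+ 3) * (1 - Phi x).
    by rewrite ler_pdivrMr// mulrAC; exact: gauss_le_cubic_tail.
  have := ler_wpM2l K0 (le_trans hi (le_trans (ler_wpM2r g0 wd) (ler_wpM2l (ltW d0) gM))).
  move=> /le_trans; apply; rewrite le_eqVlt; apply/orP; left; apply/eqP.
  by rewrite dE /E; ring.
have far_normal : 0 <= K * (1 - Phi (w k2)) <= 2 * N * (K * (1 - Phi x)) * E.
  rewrite mulr_ge0 ?subr_ge0 ?Phi_le1//=.
  have By : 3 * y <= w k2 by apply: le_trans Bk2; rewrite ler_pM2r.
  have wk21 : 1 <= w k2 by clear -By y1; lra.
  have gw : gauss (w k2) <= expR (- (3 / 2 * y ^+ 2)).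
    rewrite ler_expR lerN2.
    have : (3 * y) ^+ 2 <= w k2 ^+ 2 by rewrite ler_sqr ?nnegrE//; clear -By y1; lra.
    have := sqr_ge0 y; clear; lra.
  have := le_trans gw (gauss_tail_poly R x y x0 xy y1); rewrite -NE -/M => gp.
  have M20 : 0 <= 2 / M by rewrite divr_ge0// ltW.
  have := ler_wpM2l M20 gp.
  rewrite [leLHS]mulrAC -mulrA => {}gp.
  have := ler_wpM2l K0 (le_trans (gauss_tail_le R _ wk21) gp).
  move=> /le_trans; apply.
  have -> : K * (2 / M * (N * M * (1 - Phi x) / y ^+ 7)) =
    2 * N * (K * (1 - Phi x)) * (y ^+ 7)^-1.
    by field; rewrite !gt_eqF.
  apply: ler_wpM2l; first by rewrite !mulr_ge0.
  apply: le_trans yE.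
  by rewrite lef_pV2 ?posrE ?exprn_gt0// ler_weXn2l.
have far : 0 <= S2 <= 2 * N * C2 * q * (K * (1 - Phi x)) * E.
  have By0 : 0 <= B * y := le_trans (ltW y0) yB.
  have wB k : (k2 <= k <= n)%N ->
      B * y <= w k /\ 0 <= a k <= C2 * A * expR (- (c * w k ^+ 2)).
    move=> /andP[kk kn]; have Bk := le_trans Bk2 (wmon _ _ kk).
    by split=> //; apply: glob => //; exact: le_trans Bk.
  have cBy : 3 / 2 * y ^+ 2 <= c * (B * y) ^+ 2.
    by rewrite exprMn [leRHS]mulrA; apply: ler_wpM2r => //; exact: sqr_ge0.
  have /andP[S20 S2le] := lattice_far a w n k2 A C2 c (B * y) x y
    (mulr_ge0 C20 A0) (ltW c0) By0 cBy ny x0 xy y1 wB.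
  rewrite S20 /=; apply: (le_trans S2le); rewrite -NE -/M.
  have -> : 2 * (C2 * A) * (N * M * (1 - Phi x)) / y =
    2 * N * C2 * q * (K * (1 - Phi x)) * (y ^+ 4)^-1.
    by rewrite -KA dE; field; rewrite !gt_eqF.
  apply: ler_wpM2l; first by rewrite !mulr_ge0.
  apply: le_trans yE.
  by rewrite lef_pV2 ?posrE ?exprn_gt0// ler_weXn2l.
rewrite -[leRHS]mulrA -/E.
move: bulk near far_normal far; clear.
rewrite !ler_norml => /andP[b1 b2] /andP[n1 n2] /andP[f1 f2] /andP[g1 g2].
apply/andP; split; lra.
Qed.

(** * The log-odds function *)

Lemma ln1D_taylor {R : realType} (t : R) : `|t| <= 2^-1 -> `|ln (1 + t) - t| <= 2 * t ^+ 2.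
Proof.
rewrite ler_norml => /andP[t1 t2].
have t10 : 0 < 1 + t by lra.
have up : ln (1 + t) <= t by apply: le_ln1Dx; lra.
have lo : t / (1 + t) <= ln (1 + t).
  rewrite -[ln _]opprK -lnV ?posrE// lerNr.
  have E : (1 + t)^-1 = 1 + - (t / (1 + t)) by field; rewrite gt_eqF.
  rewrite [X in ln X]E; apply: le_ln1Dx; rewrite ltrN2 ltr_pdivrMr//; lra.
have tt : t - 2 * t ^+ 2 <= t / (1 + t).
  rewrite ler_pdivlMr//.
  have : 0 <= t ^+ 2 * (1 + 2 * t) by rewrite mulr_ge0 ?sqr_ge0//; lra.
  lra.
have := sqr_ge0 t; rewrite ler_norml => t2_ge0; apply/andP; split; lra.
Qed.

Definition log_odds {R : realType} (m : R) : R := ln (1 + m) - ln (1 - m).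

Lemma log_odds0 {R : realType} : log_odds (0 : R) = 0.
Proof. by rewrite /log_odds addr0 subr0 subrr. Qed.

Lemma log_odds_tanh {R : realType} (z : R) :
  [/\ -1 < tanh z, tanh z < 1 & log_odds (tanh z) = 2 * z].
Proof.
have p := expR_gt0 z; have q := expR_gt0 (- z).
have pq : 0 < expR z + expR (- z) by rewrite addr_gt0.
have up : 1 + tanh z = 2 * expR z / (expR z + expR (- z)).
  by rewrite /tanh; field; rewrite gt_eqF.
have lo : 1 - tanh z = 2 * expR (- z) / (expR z + expR (- z)).
  by rewrite /tanh; field; rewrite gt_eqF.
split.
- by rewrite -subr_gt0 opprK addrC up divr_gt0// mulr_gt0.
- by rewrite -subr_gt0 lo divr_gt0// mulr_gt0.
- rewrite /log_odds up lo !ln_div ?posrE ?mulr_gt0// !lnM ?posrE// !expRK.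
  lra.
Qed.

Lemma log_odds_MVT {R : realType} (a b : R) : -1 < a -> a <= b -> b < 1 ->
  exists2 xi, a <= xi <= b & log_odds b - log_odds a = 2 / (1 - xi ^+ 2) * (b - a).
Proof.
move=> a1 ab b1.
have der (z : R) : -1 < z -> z < 1 ->
    is_derive z (1 : R) (@log_odds R) (2 / (1 - z ^+ 2)).
  move=> z1 z2.
  have zp : 0 < 1 + z by lra.
  have zm : 0 < 1 - z by lra.
  have dp : is_derive z (1 : R) (@ln R \o (fun u : R => 1 + u)) ((1 + z)^-1 * (0 + 1)).
    by apply: is_derive1_comp; exact: is_derive1_ln.
  have dm : is_derive z (1 : R) (@ln R \o (fun u : R => 1 - u)) ((1 - z)^-1 * (0 - 1)).
    by apply: is_derive1_comp; exact: is_derive1_ln.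
  have := is_deriveB dp dm; rewrite add0r sub0r mulr1 mulrN1 opprK.
  have -> : (1 + z)^-1 + (1 - z)^-1 = 2 / (1 - z ^+ 2).
    by field; rewrite !gt_eqF//=; nra.
  by [].
have cont : ({within `[a, b], continuous (@log_odds R)})%classic.
  apply: derivable_within_continuous => z; rewrite in_itv/= => /andP[az zb].
  by have [] : is_derive z (1 : R) (@log_odds R) (2 / (1 - z ^+ 2)) by apply: der; lra.
have [|xi] := @MVT_segment R log_odds (fun z => 2 / (1 - z ^+ 2)) a b ab _ cont.
  by move=> z; rewrite in_itv/= => /andP[az zb]; apply: der; lra.
by rewrite in_itv/= => axib ->; exists xi.
Qed.

(** * The law of the number of up spins *)

(** The total weight of the configurations with [k] up spins, up to the factor
[exp (- beta/2)] that comes from completing the sum over pairs to the square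
of the total spin. *)
Definition spin_weight {R : realType} (beta h : R) (n k : nat) : R :=
  'C(n, k)%:R * expR (beta / (2 * n%:R) * (2 * k%:R - n%:R) ^+ 2
                      + beta * h * (2 * k%:R - n%:R)).

Lemma spin_weight_gt0 {R : realType} (beta h : R) (n k : nat) :
  (k <= n)%N -> 0 < spin_weight beta h n k.
Proof. by move=> kn; rewrite mulr_gt0 ?expR_gt0// ltr0n bin_gt0. Qed.

Lemma spin_weight_flip {R : realType} (beta h : R) (n k : nat) :
  (k <= n)%N -> spin_weight beta (- h) n (n - k) = spin_weight beta h n k.
Proof.
move=> kn; rewrite /spin_weight bin_sub// natrB//.
by congr (_ * expR _); ring.
Qed.

(** The deviation [S - n m0] when [k] spins are up. *)
Definition excess {R : realType} (m0 : R) (n k : nat) : R :=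
  2 * k%:R - n%:R - n%:R * m0.

Lemma excess_flip {R : realType} (m0 : R) (n k : nat) :
  (k <= n)%N -> excess (- m0) n (n - k) = - excess m0 n k.
Proof. by move=> kn; rewrite /excess natrB//; ring. Qed.

Lemma excessS {R : realType} (m0 : R) (n k : nat) :
  excess m0 n k.+1 = excess m0 n k + 2.
Proof. by rewrite /excess -natr1; ring. Qed.

(** The logarithm of [spin_weight] decreases like
[curvature * excess^2 / (4 n)] around equilibrium, so that the variance of the
total spin is [2 n / curvature]. *)
Definition curvature {R : realType} (beta m0 : R) : R :=
  2 / (1 - m0 ^+ 2) - 2 * beta.

Lemma ln_spin_weight {R : realType} (beta h : R) (n k : nat) : (k <= n)%N ->
  ln (spin_weight beta h n k) = ln 'C(n, k)%:R +
    (beta / (2 * n%:R) * (2 * k%:R - n%:R) ^+ 2 + beta * h * (2 * k%:R - n%:R)).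
Proof. by move=> kn; rewrite lnM ?posrE ?expR_gt0 ?ltr0n ?bin_gt0// expRK. Qed.

Lemma ln_spin_weight_step {R : realType} (beta h : R) (n k : nat) : (k < n)%N ->
  let m := (2 * k%:R - n%:R) / n%:R in
  ln (spin_weight beta h n k.+1) - ln (spin_weight beta h n k) =
  ln (1 - m) - ln (1 + m + 2 / n%:R) + 2 * beta * (m + h) + 2 * beta / n%:R.
Proof.
move=> kn m; have n0 : 0 < n%:R :> R by rewrite ltr0n (leq_ltn_trans _ kn).
rewrite !ln_spin_weight// 1?ltnW//.
have kn' : 0 < n%:R - k%:R :> R by rewrite subr_gt0 ltr_nat.
have k1 : 0 < k%:R + 1 :> R by rewrite ltr_wpDl.
have bin : ln (k%:R + 1 : R) + ln 'C(n, k.+1)%:R = ln (n%:R - k%:R : R) + ln 'C(n, k)%:R.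
  rewrite -!lnM ?posrE ?ltr0n ?bin_gt0// 1?ltnW//.
  by rewrite natr1 -natrB 1?ltnW// -!natrM mul_bin_left.
have mE : 1 - m = (n%:R - k%:R) * (2 / n%:R).
  by rewrite /m; field; rewrite gt_eqF.
have pE : 1 + m + 2 / n%:R = (k%:R + 1) * (2 / n%:R).
  by rewrite /m; field; rewrite gt_eqF.
have n2 : 0 < 2 / n%:R :> R by rewrite divr_gt0.
have mL : ln (1 - m) = ln (n%:R - k%:R) + ln (2 / n%:R).
  by rewrite mE lnM ?posrE.
have pL : ln (1 + m + 2 / n%:R) = ln (k%:R + 1) + ln (2 / n%:R).
  by rewrite pE lnM ?posrE.
rewrite mL pL -[k.+1%:R]natr1.
have E : 2 * beta * (m + h) + 2 * beta / n%:R =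
  (beta / (2 * n%:R) * (2 * (k%:R + 1) - n%:R) ^+ 2 + beta * h * (2 * (k%:R + 1) - n%:R))
 - (beta / (2 * n%:R) * (2 * k%:R - n%:R) ^+ 2 + beta * h * (2 * k%:R - n%:R)).
  by rewrite /m; field; rewrite gt_eqF.
move: bin E; clear; lra.
Qed.

Lemma tanhN {R : realType} (z : R) : tanh (- z) = - tanh z.
Proof.
by rewrite /tanh opprK -mulNr opprB [X in _ / X]addrC.
Qed.

(** The case [h = 0] has content: then [beta < 1], and the slope of
[log_odds], which is at least [2], excludes a nonzero solution of
[log_odds m = 2 beta m]. *)
Lemma equilibrium_ge0 {R : realType} (beta h m0 : R) : 0 <= h ->
  (0 < beta < 1) \/ (1 <= beta /\ h != 0) ->
  m0 = tanh (beta * (m0 + h)) -> 0 <= m0 * h -> 0 <= m0.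
Proof.
move=> h0 hpar hm0 hm0h; rewrite leNgt; apply/negP => m0n.
have h_0 : h = 0.
  apply/eqP; rewrite eq_le h0 andbT leNgt; apply/negP => hp.
  by move: hm0h; rewrite leNgt pmulr_llt0// m0n.
case: hpar => [/andP[b0 b1]|[_]]; last by rewrite h_0 eqxx.
have [m1 m2 lo] := log_odds_tanh (beta * (m0 + h)).
rewrite -hm0 h_0 addr0 in m1 m2 lo.
have [xi /andP[xi1 xi2]] := log_odds_MVT m0 0 m1 (ltW m0n) ltr01.
rewrite log_odds0 lo => E.
have xi21 : 0 < 1 - xi ^+ 2.
  have -> : 1 - xi ^+ 2 = (1 - xi) * (1 + xi) by ring.
  by rewrite mulr_gt0//; lra.
have : 2 * 1 <= 2 / (1 - xi ^+ 2).
  rewrite ler_pM2l// -[leLHS]invr1 lef_pV2 ?posrE//.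
  by rewrite lerBlDr lerDl sqr_ge0.
rewrite mulr1 => slope.
have : 2 * (0 - m0) <= 2 / (1 - xi ^+ 2) * (0 - m0) by rewrite ler_wpM2r//; lra.
rewrite -E.
have : 0 < (1 - beta) * - m0 by rewrite mulr_gt0; lra.
lra.
Qed.

(** For [h > 0], by the mean value theorem [2 beta (m0 + h) = log_odds m0] is at
most [2 m0 / (1 - m0^2)], and [beta h > 0] makes the comparison with
[2 beta m0] strict. For [h = 0], [beta < 1 <= 1 / (1 - m0^2)]. *)
Lemma curvature_gt0 {R : realType} (beta h m0 : R) :
  (0 < beta < 1) \/ (1 <= beta /\ h != 0) ->
  m0 = tanh (beta * (m0 + h)) -> 0 <= m0 * h -> 0 < curvature beta m0.
Proof.
wlog h0 : h m0 / 0 <= h => [sym|] hpar hm0 hm0h.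
  have [/sym|/ltW h0] := leP 0 h; first exact.
  rewrite /curvature -sqrrN; apply: (sym (- h)).
  - by rewrite oppr_ge0.
  - by case: hpar => [|[b hn]]; [left|right; rewrite oppr_eq0].
  - by rewrite -opprD mulrN tanhN -hm0.
  - by rewrite mulrNN.
have m00 := equilibrium_ge0 beta h m0 h0 hpar hm0 hm0h.
have b0 : 0 < beta by case: hpar => [/andP[]//|[b _]]; lra.
have [m1 m2 lo] := log_odds_tanh (beta * (m0 + h)).
rewrite -hm0 in m1 m2 lo.
have q0 : 0 < 1 - m0 ^+ 2.
  have -> : 1 - m0 ^+ 2 = (1 - m0) * (1 + m0) by ring.
  by rewrite mulr_gt0//; lra.
rewrite /curvature subr_gt0.
move: m00; rewrite le_eqVlt => /orP[/eqP m00|m0p].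
  move: lo; rewrite -m00 log_odds0 add0r => /esym/eqP.
  rewrite expr0n/= subr0 divr1 !mulf_eq0 pnatr_eq0/= gt_eqF//= => /eqP h_0.
  by case: hpar => [/andP[_ b1]|[_]]; [lra|rewrite h_0 eqxx].
have [xi /andP[xi1 xi2]] := log_odds_MVT 0 m0 (ltrN10 _) (ltW m0p) m2.
rewrite log_odds0 lo !subr0 => E.
have xim : xi ^+ 2 <= m0 ^+ 2 by rewrite ler_sqr ?nnegrE// ltW.
have slope : 2 / (1 - xi ^+ 2) * m0 <= 2 / (1 - m0 ^+ 2) * m0.
  by rewrite ler_pM2r// ler_pM2l// lef_pV2 ?posrE//; lra.
rewrite -(ltr_pM2r m0p); rewrite -E in slope.
have bh : 0 <= beta * h by apply: mulr_ge0 => //; exact: ltW.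
have [h_0|hn] := eqVneq h 0.
  case: hpar => [/andP[_ b1]|[_]]; last by rewrite h_0 eqxx.
  apply: (@lt_le_trans _ _ (2 * m0)); first by rewrite ltr_pM2r//; lra.
  rewrite ler_pM2r// -[leLHS]mulr1 ler_pM2l// -[leLHS]invr1 lef_pV2 ?posrE//.
  by rewrite lerBlDr lerDl sqr_ge0.
have hp : 0 < h by rewrite lt_def hn.
have : 0 < beta * h by rewrite mulr_gt0.
lra.
Qed.

Lemma iterated_step_le {R : realType} (f : nat -> R) (b : R) (l k : nat) :
  (l <= k)%N -> (forall j, (l <= j < k)%N -> f j.+1 - f j <= b) ->
  f k - f l <= (k - l)%:R * b.
Proof.
move=> lk step; rewrite -(telescope_sumr f lk) mulr_natl -sumr_const_nat.
exact: ler_sum_nat.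
Qed.

(** First-order expansion at [m0]: the zeroth-order terms cancel by the
equation [log_odds m0 = 2 beta (m0 + h)]. *)
Lemma ln_spin_weight_step_local {R : realType} (beta h m0 : R) :
  0 <= beta -> -1 < m0 -> m0 < 1 -> log_odds m0 = 2 * (beta * (m0 + h)) ->
  exists C eps : R, [/\ 0 <= C, 0 < eps & forall n k, (k < n)%N ->
    let e := excess m0 n k / n%:R in
    `|e| <= eps -> 2 / n%:R <= eps ->
    `|ln (spin_weight beta h n k.+1) - ln (spin_weight beta h n k)
      + curvature beta m0 * e| <= C * (e ^+ 2 + n%:R^-1)].
Proof.
move=> b0 m1 m2 lo.
have p0 : 0 < 1 + m0 by lra.
have q0 : 0 < 1 - m0 by lra.
pose p := (1 + m0)^-1; pose q := (1 - m0)^-1.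
have pV : 0 < p by rewrite invr_gt0.
have qV : 0 < q by rewrite invr_gt0.
have pE : (1 + m0) * p = 1 by rewrite divff// gt_eqF.
have qE : (1 - m0) * q = 1 by rewrite divff// gt_eqF.
exists (2 * q ^+ 2 + 16 * p ^+ 2 + 2 * p + 2 * beta),
  (Num.min (1 - m0) (1 + m0) / 4); split.
- by rewrite !addr_ge0// mulr_ge0// ?sqr_ge0// ltW.
- by rewrite divr_gt0// lt_min q0 p0.
move=> n k kn e; set eps := _ / 4 => e_le n_le.
have n0 : 0 < n%:R :> R by rewrite ltr0n (leq_ltn_trans _ kn).
have n1 : 1 <= n%:R :> R by rewrite ler1n (leq_ltn_trans _ kn).
have epsq : eps <= (1 - m0) / 4 by rewrite ler_pM2r// ge_min lexx.
have epsp : eps <= (1 + m0) / 4 by rewrite ler_pM2r// ge_min lexx orbT.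
set N := n%:R^-1 in n_le *.
have N0 : 0 < N by rewrite invr_gt0.
have N1 : N <= 1 by rewrite invf_le1.
rewrite ln_spin_weight_step//.
have mE : (2 * k%:R - n%:R) / n%:R = m0 + e.
  by rewrite /e /excess; field; rewrite gt_eqF.
rewrite mE -/N.
have e1 : `|- (e * q)| <= 2^-1.
  rewrite normrN normrM (gtr0_norm qV) ler_pdivrMr//; lra.
have e2 : `|(e + 2 * N) * p| <= 2^-1.
  rewrite normrM (gtr0_norm pV) ler_pdivrMr//.
  have := ler_normD e (2 * N); rewrite (ger0_norm (_ : 0 <= 2 * N)); lra.
have t1 := ln1D_taylor _ e1; have t2 := ln1D_taylor _ e2.
have pos1 : 0 < 1 + - (e * q) by move: e1; rewrite ler_norml => /andP[]; lra.
have pos2 : 0 < 1 + (e + 2 * N) * p by move: e2; rewrite ler_norml => /andP[]; lra.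
have L1 : ln (1 - (m0 + e)) = ln (1 - m0) + ln (1 + - (e * q)).
  rewrite -lnM ?posrE//; congr ln.
  by rewrite mulrDr mulr1 mulrN mulrCA qE; ring.
have L2 : ln (1 + (m0 + e) + 2 * N) = ln (1 + m0) + ln (1 + (e + 2 * N) * p).
  rewrite -lnM ?posrE//; congr ln.
  by rewrite mulrDr mulr1 mulrCA pE; ring.
have kE : curvature beta m0 = q + p - 2 * beta.
  by rewrite /curvature /p /q; field; rewrite !gt_eqF//; nra.
rewrite L1 L2 kE.
rewrite /log_odds in lo.
have -> : ln (1 - m0) + ln (1 + - (e * q)) - (ln (1 + m0) + ln (1 + (e + 2 * N) * p))
    + 2 * beta * (m0 + e + h) + 2 * beta * N + (q + p - 2 * beta) * e
  = (ln (1 + - (e * q)) - - (e * q)) - (ln (1 + (e + 2 * N) * p) - (e + 2 * N) * p)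
    + (2 * beta * N - 2 * N * p) by lra.
move: t1 t2; set r1 := ln _ - _; set r2 := ln _ - _ => t1 t2.
have b1 : 2 * (- (e * q)) ^+ 2 <= 2 * q ^+ 2 * (e ^+ 2 + N).
  rewrite sqrrN exprMn -mulrA ler_pM2l// mulrC ler_wpM2l ?sqr_ge0//.
  by rewrite lerDl ltW.
have b2 : 2 * ((e + 2 * N) * p) ^+ 2 <= 16 * p ^+ 2 * (e ^+ 2 + N).
  have : N ^+ 2 <= N by rewrite expr2 ler_piMl// ltW.
  have sq : 2 * (e + 2 * N) ^+ 2 <= 4 * e ^+ 2 + 16 * N ^+ 2.
    have := sqr_ge0 (e - 2 * N); clear; lra.
  have e2_0 := sqr_ge0 e; have p2_0 := sqr_ge0 p => NN.
  have : 2 * (e + 2 * N) ^+ 2 * p ^+ 2 <= 16 * (e ^+ 2 + N) * p ^+ 2.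
    by apply: ler_wpM2r => //; move: sq e2_0 NN; clear; lra.
  by rewrite exprMn; clear; lra.
have b3 : `|2 * beta * N - 2 * N * p| <= (2 * p + 2 * beta) * (e ^+ 2 + N).
  have : 0 <= (2 * p + 2 * beta) * e ^+ 2 by rewrite mulr_ge0 ?sqr_ge0//; lra.
  have : 0 <= beta * N by rewrite mulr_ge0// ltW.
  have : 0 <= p * N by rewrite mulr_ge0// ltW.
  rewrite ler_norml => *; apply/andP; split; lra.
apply: (le_trans (ler_normD _ _)).
have := ler_normB r1 r2; clear -t1 t2 b1 b2 b3; lra.
Qed.

(** * A global Gaussian bound on the weights *)

(** A lattice point [l] next to [n m0] whose weight controls all others with
a Gaussian decay. The point [l] is part of the data so that the notion is
stable under the spin flip, which would exchange the roundings of [n m0] from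
above and from below. *)
Definition dominating_site {R : realType} (beta h m0 C c : R) (n l : nat) :=
  [/\ (l <= n)%N, `|excess m0 n l| <= 2 & forall k, (k <= n)%N ->
    spin_weight beta h n k
    <= C * spin_weight beta h n l * expR (- (c * excess m0 n k ^+ 2 / n%:R))].

Lemma dominating_site_flip {R : realType} (beta h m0 C c : R) (n l : nat) :
  dominating_site beta h m0 C c n l ->
  dominating_site beta (- h) (- m0) C c n (n - l).
Proof.
move=> [l_n le2 dom]; split; first exact: leq_subr.
  by rewrite excess_flip// normrN.
move=> k kn; rewrite spin_weight_flip//.
rewrite -{1 2}(subKn kn) spin_weight_flip ?leq_subr// excess_flip ?leq_subr//.
by rewrite sqrrN; apply: dom; exact: leq_subr.
Qed.

Lemma central_site {R : realType} (m0 : R) (n : nat) : (0 < n)%N -> -1 < m0 -> m0 < 1 ->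
  exists2 l, (l <= n)%N & 0 <= excess m0 n l < 2.
Proof.
move=> n0 m1 m2; have nR : 0 < n%:R :> R by rewrite ltr0n.
have endp : 0 <= excess m0 n n.
  rewrite /excess; have : 0 <= n%:R * (1 - m0) by rewrite mulr_ge0//; lra.
  lra.
have ex : exists l, 0 <= excess m0 n l by exists n.
case: (ex_minnP ex) => l l0 lmin; exists l; first exact: lmin.
rewrite l0 /=; case: l l0 lmin => [|l] l0 lmin.
  move: l0; rewrite /excess.
  have : 0 < n%:R * (1 + m0) by rewrite mulr_gt0//; lra.
  lra.
rewrite excessS -ltrBrDr subrr ltNge; apply/negP => /lmin.
by rewrite ltnn.
Qed.

(** Above equilibrium [log_odds] stays above its tangent at [m0], so the
weights decrease at least as fast as the local expansion predicts. *)
Lemma spin_weight_up {R : realType} (beta h m0 : R) (n k : nat) : (k < n)%N ->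
  0 <= m0 -> m0 < 1 -> log_odds m0 = 2 * (beta * (m0 + h)) ->
  0 <= excess m0 n k ->
  ln (spin_weight beta h n k.+1) - ln (spin_weight beta h n k)
  <= - (curvature beta m0 * (excess m0 n k / n%:R)) + 2 * beta / n%:R.
Proof.
move=> kn m00 m01 lo d0; rewrite ln_spin_weight_step//.
have n0 : 0 < n%:R :> R by rewrite ltr0n (leq_ltn_trans _ kn).
have kR : k%:R < n%:R :> R by rewrite ltr_nat.
set e := excess m0 n k / n%:R; set m := (2 * k%:R - n%:R) / n%:R.
have e0 : 0 <= e by rewrite divr_ge0// ltW.
have mE : m = m0 + e by rewrite /m /e /excess; field; rewrite gt_eqF.
have m1 : m < 1 by rewrite /m ltr_pdivrMr//; lra.
have N0 : 0 < n%:R^-1 :> R by rewrite invr_gt0.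
have m0N : -1 < m0 := lt_le_trans (ltrN10 _) m00.
have mm : m0 <= m by rewrite mE lerDl.
have [xi /andP[xi1 xi2]] := log_odds_MVT m0 m m0N mm m1.
rewrite /log_odds in lo *.
have slope : 2 / (1 - m0 ^+ 2) * e <= 2 / (1 - xi ^+ 2) * e.
  apply: ler_wpM2r => //; rewrite ler_pM2l// lef_pV2 ?posrE; try nra.
have lnm : ln (1 + m) <= ln (1 + m + 2 / n%:R).
  by rewrite ler_ln ?posrE ?lerDl ?divr_ge0 ?(ltW n0)//; lra.
rewrite /curvature mE in slope lnm *; lra.
Qed.

(** [log_odds] is convex on [[0, 1)] and vanishes at [0]: the chord slopes
before and after [m] are derivatives at ordered points. *)
Lemma log_odds_star_shaped {R : realType} (m m0 : R) :
  0 <= m -> m <= m0 -> m0 < 1 -> m0 * log_odds m <= m * log_odds m0.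
Proof.
move=> m_0 mm0 m01.
have m1 : m < 1 by exact: le_lt_trans m01.
have [x1 /andP[x10 x1m]] := log_odds_MVT 0 m (ltrN10 _) m_0 m1.
rewrite log_odds0 !subr0; set G1 := 2 / _ => E1.
have mN1 : -1 < m by exact: lt_le_trans m_0.
have [x2 /andP[mx2 x2m]] := log_odds_MVT m m0 mN1 mm0 m01.
set G2 := 2 / _ => E2.
have G12 : G1 <= G2.
  have s12 : x1 ^+ 2 <= x2 ^+ 2.
    by rewrite ler_sqr ?nnegrE// ?(le_trans x1m)// ?(le_trans x10)// (le_trans x1m).
  have s21 : x2 ^+ 2 < 1.
    rewrite -(expr1n _ 2) ltr_sqr ?nnegrE//; first exact: le_lt_trans m01.
    exact: le_trans m_0 _.
  by rewrite ler_pM2l// lef_pV2 ?posrE; lra.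
have : 0 <= (G2 - G1) * (m * (m0 - m)) by rewrite !mulr_ge0 ?subr_ge0.
have -> : log_odds m0 = G1 * m + G2 * (m0 - m) by rewrite -E1 -E2; ring.
by rewrite E1; lra.
Qed.

(** Between [0] and [m0], the graph of [log_odds] lies below its chord through
the origin, which leaves a drift towards [m0] proportional to the distance. *)
Lemma spin_weight_down {R : realType} (beta h m0 : R) (n k : nat) : (k < n)%N ->
  0 <= beta -> 0 < m0 -> m0 < 1 -> log_odds m0 = 2 * (beta * (m0 + h)) ->
  (n <= 2 * k)%N -> excess m0 n k <= 0 ->
  2 * beta * h / m0 * - (excess m0 n k / n%:R) - 2 / n%:R
  <= ln (spin_weight beta h n k.+1) - ln (spin_weight beta h n k).
Proof.
move=> kn b0 m00 m01 lo nk d0; rewrite ln_spin_weight_step//.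
have n0 : 0 < n%:R :> R by rewrite ltr0n (leq_ltn_trans _ kn).
have kR : n%:R <= 2 * k%:R :> R by rewrite -natrM ler_nat.
set e := excess m0 n k / n%:R; set m := (2 * k%:R - n%:R) / n%:R.
have mE : m = m0 + e by rewrite /m /e /excess; field; rewrite gt_eqF.
have m_0 : 0 <= m by rewrite /m divr_ge0 ?(ltW n0)// subr_ge0.
have mm0 : m <= m0.
  by rewrite mE gerDl /e ler_pdivrMr// mul0r.
have star := log_odds_star_shaped m m0 m_0 mm0 m01.
have N0 : 0 < n%:R^-1 :> R by rewrite invr_gt0.
have m10 : 0 < 1 + m by lra.
have lnm : ln (1 + m + 2 / n%:R) <= ln (1 + m) + 2 / n%:R.
  have x0 : 0 < 1 + 2 / n%:R / (1 + m) by rewrite ltr_wpDr// divr_ge0 ?divr_ge0 ?ltW.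
  have -> : 1 + m + 2 / n%:R = (1 + m) * (1 + 2 / n%:R / (1 + m)).
    by field; rewrite !gt_eqF.
  rewrite lnM ?posrE// lerD2l.
  apply: (@le_trans _ _ (2 / n%:R / (1 + m))).
    by apply: le_ln1Dx; move: x0; lra.
  by rewrite ler_pdivrMr// ler_peMr ?divr_ge0 ?(ltW n0)//; lra.
have H : 2 * beta * h / m0 * - e <= 2 * beta * (m + h) - log_odds m.
  rewrite -(ler_pM2l m00).
  have -> : m0 * (2 * beta * h / m0 * - e) = 2 * beta * h * (m0 - m).
    by rewrite mE; field; rewrite gt_eqF.
  by move: star; rewrite lo; lra.
have : 0 <= 2 * beta / n%:R by rewrite divr_ge0 ?(ltW n0)//; lra.
move: lnm H; rewrite /log_odds; lra.
Qed.

Lemma spin_weight_reflect {R : realType} (beta h : R) (n k : nat) : (k <= n)%N ->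
  spin_weight beta h n k = spin_weight beta h n (n - k)
    * expR (2 * beta * h * (2 * k%:R - n%:R)).
Proof.
move=> kn; rewrite /spin_weight bin_sub// natrB// -[RHS]mulrA -expRD.
by congr (_ * expR _); ring.
Qed.

(** With [c] small the quantity [ln (spin_weight k) + c * excess^2 / n] changes
by at most [O(1/n)] in the wrong direction at each step away from the centre,
hence by [O(1)] over the whole half [2k >= n]. Points with [2k < n] are compared
with their mirror image; the price of reflecting the Gaussian bound is
[4 c m0 |2k - n|], covered by the field term as [2 c m0 <= beta h]. *)
Lemma dominating_site_nonneg {R : realType} (beta h m0 : R) :
  0 <= beta -> 0 <= m0 -> m0 < 1 -> log_odds m0 = 2 * (beta * (m0 + h)) ->
  0 < curvature beta m0 -> 0 <= beta * h -> m0 = 0 \/ 0 < beta * h ->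
  exists C c : R, [/\ 0 <= C, 0 < c & forall n, (0 < n)%N ->
    exists l, dominating_site beta h m0 C c n l].
Proof.
move=> b0 m00 m01 lo k0 bh0 no_field.
have [c [c0 ck cm]] : exists c : R,
    [/\ 0 < c, 4 * c <= curvature beta m0 & 2 * c * m0 <= beta * h].
  case: no_field => [m0_0|bh].
    exists (curvature beta m0 / 4); split; [by rewrite divr_gt0|lra|by rewrite m0_0 mulr0].
  exists (Num.min (curvature beta m0 / 4) (beta * h / 2)); split.
  - by rewrite lt_min !divr_gt0.
  - by rewrite mulrC -ler_pdivlMr// ge_min lexx.
  - have : 2 * Num.min (curvature beta m0 / 4) (beta * h / 2) <= beta * h.
      by rewrite mulrC -ler_pdivlMr// ge_min lexx orbT.
    have : 0 <= Num.min (curvature beta m0 / 4) (beta * h / 2).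
      by rewrite le_min !divr_ge0// ltW.
    set z := Num.min _ _ => z0 z1.
    have : 2 * z * m0 <= 2 * z * 1 by apply: ler_wpM2l; lra.
    lra.
exists (expR (2 * beta + 2 + 8 * c)), c; split=> //.
move=> n n0.
have nR : 0 < n%:R :> R by rewrite ltr0n.
have nV : 0 < n%:R^-1 :> R by rewrite invr_gt0.
have nV1 : n%:R^-1 <= 1 :> R by rewrite invf_le1// ler1n.
have [l l_n /andP[dl0 dl2]] := central_site m0 n n0 (lt_le_trans (ltrN10 _) m00) m01.
exists l; split=> //; first by rewrite ger0_norm// ltW.
pose F k := ln (spin_weight beta h n k) + c * excess m0 n k ^+ 2 / n%:R.
have FS k : F k.+1 - F k = ln (spin_weight beta h n k.+1) - ln (spin_weight beta h n k)
    + 4 * c * (excess m0 n k / n%:R) + 4 * c / n%:R.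
  by rewrite /F excessS; field; rewrite gt_eqF.
have dmon i j : (i <= j)%N -> excess m0 n i <= excess m0 n j.
  by move=> ij; rewrite /excess !lerD2r ler_pM2l// ler_nat.
have Fup k : (l <= k)%N -> (k <= n)%N -> F k - F l <= 2 * beta + 4 * c.
  move=> lk kn; have [] : F k - F l <= (k - l)%:R * ((2 * beta + 4 * c) / n%:R) /\ True.
    split=> //; apply: iterated_step_le => // j /andP[lj jk].
    have dj : 0 <= excess m0 n j by apply: le_trans (dmon _ _ lj).
    have := spin_weight_up beta h m0 n j (leq_trans jk kn) m00 m01 lo dj.
    rewrite FS; have : 0 <= (curvature beta m0 - 4 * c) * (excess m0 n j / n%:R).
      by rewrite mulr_ge0 ?subr_ge0// divr_ge0// ltW.
    clear; lra.
  move=> H _; apply: (le_trans H).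
  rewrite mulrCA ler_piMr//; first lra.
  by rewrite ler_pdivrMr// mul1r ler_nat (leq_trans (leq_subr _ _)).
have Fdown k : (k <= l)%N -> (n <= 2 * k)%N -> F k - F l <= 2.
  move=> kl nk.
  have : - F l - - F k <= (l - k)%:R * (2 / n%:R).
    apply: (iterated_step_le (fun j => - F j)) => // j /andP[kj jl].
    have dj : excess m0 n j < 0.
      have := dmon _ _ jl; rewrite excessS; lra.
    have nj : (n <= 2 * j)%N by rewrite (leq_trans nk)// leq_mul2l kj orbT.
    have nRj : n%:R <= 2 * j%:R :> R by rewrite -natrM ler_nat.
    have m0p : 0 < m0.
      rewrite lt_def m00 andbT; apply/eqP => m0_0.
      by move: dj; rewrite /excess m0_0; lra.
    have := spin_weight_down beta h m0 n j (leq_trans jl l_n) b0 m0p m01 lo nj (ltW dj).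
    have e0 : 0 <= - (excess m0 n j / n%:R).
      by rewrite oppr_ge0 pmulr_lle0// ltW.
    have c4 : 4 * c <= 2 * beta * h / m0 by rewrite ler_pdivlMr//; lra.
    have := ler_wpM2r e0 c4.
    have : 0 <= c / n%:R by rewrite divr_ge0// ltW.
    have := FS j; clear; lra.
  have : (l - k)%:R * (2 / n%:R) <= 2 :> R.
    rewrite mulrCA ler_piMr// ler_pdivrMr// mul1r ler_nat.
    by rewrite (leq_trans (leq_subr _ _)).
  clear; lra.
have upper k : (k <= n)%N -> (n <= 2 * k)%N -> spin_weight beta h n k <=
    expR (2 * beta + 2 + 8 * c) * spin_weight beta h n l
    * expR (- (c * excess m0 n k ^+ 2 / n%:R)).
  move=> kn nk; have wk := spin_weight_gt0 beta h n k kn; have wl := spin_weight_gt0 beta h n l l_n.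
  rewrite -[leLHS]lnK ?posrE// -[X in _ * X * _]lnK ?posrE// -!expRD ler_expR.
  have : F k - F l <= 2 * beta + 2 + 4 * c.
    case: (leqP l k) => [lk|/ltnW kl].
      by have := Fup k lk kn; lra.
    by have := Fdown k kl nk; lra.
  have : c * excess m0 n l ^+ 2 / n%:R <= 4 * c.
    rewrite ler_pdivrMr// mulrC.
    have : excess m0 n l ^+ 2 <= 2 ^+ 2 by rewrite ler_sqr ?nnegrE// ltW.
    have n1 : 1 <= n%:R :> R by rewrite ler1n.
    move=> sq; apply: (@le_trans _ _ (4 * c)); first by rewrite ler_pM2r//; lra.
    by rewrite ler_peMr// ltW// mulr_gt0.
  rewrite /F; clear; lra.
move=> k kn; have [nk|nk] := leqP n (2 * k); first exact: upper.
have nk' : (n <= 2 * (n - k))%N by move: kn nk; clear; lia.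
have := upper (n - k)%N (leq_subr _ _) nk'.
rewrite (spin_weight_reflect _ _ _ _ kn) => up.
have := ler_wpM2r (expR_ge0 (2 * beta * h * (2 * k%:R - n%:R))) up.
move=> /le_trans; apply; rewrite -[leLHS]mulrA -expRD.
apply: ler_wpM2l.
  by rewrite mulr_ge0 ?expR_ge0 ?ltW ?spin_weight_gt0.
rewrite ler_expR.
have s0 : 2 * k%:R - n%:R <= 0 :> R.
  by rewrite subr_le0 -natrM ler_nat ltnW.
have -> : c * excess m0 n k ^+ 2 / n%:R = c * excess m0 n (n - k) ^+ 2 / n%:R
    - 4 * c * m0 * (2 * k%:R - n%:R).
  by rewrite /excess natrB//; field; rewrite gt_eqF.
have : 0 <= (beta * h - 2 * c * m0) * - (2 * k%:R - n%:R).
  by rewrite mulr_ge0 ?subr_ge0 ?oppr_ge0.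
clear; lra.
Qed.

(** The spin flip [(h, m0, k) -> (-h, -m0, n - k)] reduces to [h >= 0]. *)
Lemma dominating_site_exists {R : realType} (beta h m0 : R) :
  (0 < beta < 1) \/ (1 <= beta /\ h != 0) ->
  m0 = tanh (beta * (m0 + h)) -> 0 <= m0 * h ->
  exists C c : R, [/\ 0 <= C, 0 < c & forall n, (0 < n)%N ->
    exists l, dominating_site beta h m0 C c n l].
Proof.
wlog h0 : h m0 / 0 <= h => [sym|] hpar hm0 hm0h.
  have [/sym|/ltW h0] := leP 0 h; first exact.
  have [||||C [c [C0 c0 dom]]] := sym (- h) (- m0).
  - by rewrite oppr_ge0.
  - by case: hpar => [|[b hn]]; [left|right; rewrite oppr_eq0].
  - by rewrite -opprD mulrN tanhN -hm0.
  - by rewrite mulrNN.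
  exists C, c; split=> // n n0; have [l /dominating_site_flip] := dom n n0.
  by rewrite !opprK => doml; exists (n - l)%N.
have m00 := equilibrium_ge0 beta h m0 h0 hpar hm0 hm0h.
have b0 : 0 < beta by case: hpar => [/andP[]//|[b _]]; lra.
have [m1 m2 lo] := log_odds_tanh (beta * (m0 + h)).
rewrite -hm0 in m1 m2 lo.
have k0 := curvature_gt0 beta h m0 hpar hm0 hm0h.
have bh0 : 0 <= beta * h by rewrite mulr_ge0// ltW.
apply: dominating_site_nonneg lo k0 bh0 _ => //; first exact: ltW.
move: h0; rewrite le_eqVlt => /orP[/eqP h_0|hp]; last by right; rewrite mulr_gt0.
left; apply/eqP; rewrite eq_le m00 andbT -oppr_ge0.
apply: (equilibrium_ge0 beta h) => //; first by rewrite -h_0.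
  by rewrite -h_0 addr0 mulrN tanhN -[in RHS](addr0 m0) h_0 -hm0.
by rewrite -h_0 mulr0.
Qed.

(** * Gaussian approximation near equilibrium *)

Lemma expR_sub1_le {R : realType} (t : R) : `|expR t - 1| <= `|t| * expR `|t|.
Proof.
have [t0|t0] := leP 0 t.
  rewrite !ger0_norm ?subr_ge0 -?expR0 ?ler_expR//.
  have := expR_ge1Dx (- t) => /(ler_wpM2l (expR_ge0 t)).
  by rewrite expRxMexpNx_1 expR0; lra.
rewrite ltr0_norm ?subr_lt0 ?expR_lt1// (ltr0_norm t0).
have e1 : 1 <= expR (- t) by rewrite -expR0 ler_expR; lra.
have := expR_ge1Dx t; have : - t * 1 <= - t * expR (- t) by apply: ler_wpM2l => //; lra.
lra.
Qed.

Lemma cube_sum_le {R : realType} (x : R) : 0 <= x -> (1 + x) ^+ 3 <= 4 * (1 + x ^+ 3).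
Proof.
move=> x0; have : 0 <= (x - 1) ^+ 2 * (x + 1) by rewrite mulr_ge0 ?sqr_ge0//; lra.
lra.
Qed.

Lemma iterated_step_norm {R : realType} (f : nat -> R) (b : R) (i j : nat) :
  (forall t, (minn i j <= t < maxn i j)%N -> `|f t.+1 - f t| <= b) ->
  `|f i - f j| <= `|i%:R - j%:R| * b.
Proof.
wlog ij : i j / (j <= i)%N => [sym|] step.
  have [ij|/ltnW ij] := leqP j i; first exact: sym.
  by rewrite distrC (distrC i%:R); apply: sym => // t; rewrite minnC maxnC; exact: step.
rewrite (minn_idPr ij) (maxn_idPl ij) in step.
rewrite -natrB// normr_nat ler_norml lerNl opprB.
rewrite (iterated_step_le f b j i ij) ?andbT; last first.
  by move=> t /step; rewrite ler_norml => /andP[].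
have := iterated_step_le (fun t => - f t) b j i ij; rewrite opprK addrC; apply.
by move=> t /step; rewrite ler_norml => /andP[]; lra.
Qed.

(** From [l] to [k] there are at most [D] steps, each with an error
[O(D^2/n^2 + 1/n)]. *)
Lemma ln_spin_weight_near {R : realType} (beta h m0 : R) :
  0 <= beta -> -1 < m0 -> m0 < 1 -> log_odds m0 = 2 * (beta * (m0 + h)) ->
  0 < curvature beta m0 ->
  exists C eps : R, [/\ 0 <= C, 0 < eps & forall n k l, (k <= n)%N -> (l <= n)%N ->
    (0 < n)%N -> `|excess m0 n l| <= 2 ->
    let D := `|excess m0 n k| + 2 in
    D / n%:R <= eps ->
    `|ln (spin_weight beta h n k) - ln (spin_weight beta h n l)
      + curvature beta m0 / 4 * (excess m0 n k ^+ 2 / n%:R)|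
    <= C * (D ^+ 3 / n%:R ^+ 2 + D / n%:R)].
Proof.
move=> b0 m1 m2 lo k0.
have [C [eps [C0 eps0 step]]] := ln_spin_weight_step_local beta h m0 b0 m1 m2 lo.
set kap := curvature beta m0 in k0 step *.
exists (C + 2 * kap), eps; split=> //; first by rewrite addr_ge0// mulr_ge0// ltW.
move=> n k l kn l_n n0 dl D Deps.
have nR : 0 < n%:R :> R by rewrite ltr0n.
have N0 : 0 < n%:R^-1 :> R by rewrite invr_gt0.
have D2 : 2 <= D by rewrite /D lerDr.
pose F j := ln (spin_weight beta h n j) + kap / 4 * (excess m0 n j ^+ 2 / n%:R).
pose b := (C + kap) * (D ^+ 2 / n%:R ^+ 2 + n%:R^-1).
have between j : (minn k l <= j < maxn k l)%N -> `|F j.+1 - F j| <= b.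
  move=> /andP[j1 j2].
  have jn : (j < n)%N by rewrite (leq_trans j2)// geq_max kn l_n.
  have dmon i i' : (i <= i')%N -> excess m0 n i <= excess m0 n i'.
    by move=> ij; rewrite /excess !lerD2r ler_pM2l// ler_nat.
  have dj : `|excess m0 n j| <= D.
    move: dl; rewrite /D !ler_norml => /andP[dl1 dl2].
    have := ler_norm (excess m0 n k); have := ler_norm (- excess m0 n k).
    rewrite normrN => a1 a2; have := dmon _ _ j1; have := dmon _ _ (ltnW j2).
    have nk := normr_ge0 (excess m0 n k).
    rewrite /minn /maxn; case: ltnP => _ u v; apply/andP; split; lra.
  have ej : `|excess m0 n j / n%:R| <= D / n%:R.
    by rewrite normrM (gtr0_norm N0) ler_pM2r.
  have n2 : 2 / n%:R <= eps by apply: le_trans Deps; rewrite ler_pM2r.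
  have := step n j jn (le_trans ej Deps) n2; set L := ln _ - _.
  have -> : F j.+1 - F j = L + kap * (excess m0 n j / n%:R) + kap / n%:R.
    by rewrite /F /L excessS; field; rewrite gt_eqF.
  move=> st; apply: (le_trans (ler_normD _ _)).
  rewrite (ger0_norm (_ : 0 <= kap / n%:R)) ?divr_ge0 ?(ltW nR) ?(ltW k0)//.
  have sq : (excess m0 n j / n%:R) ^+ 2 <= D ^+ 2 / n%:R ^+ 2.
    rewrite -expr_div_n -[leLHS]real_normK ?num_real//.
    by rewrite ler_sqr ?nnegrE// divr_ge0 ?(ltW nR)//; lra.
  have : C * ((excess m0 n j / n%:R) ^+ 2 + n%:R^-1) <= C * (D ^+ 2 / n%:R ^+ 2 + n%:R^-1).
    by apply: ler_wpM2l => //; rewrite lerD2r.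
  have : 0 <= kap * (D ^+ 2 / n%:R ^+ 2).
    by rewrite mulr_ge0 ?(ltW k0)// divr_ge0// ?sqr_ge0.
  move: st; rewrite /b; clear; lra.
have b_ge0 : 0 <= b.
  apply: mulr_ge0; first by rewrite addr_ge0// ltW.
  by rewrite addr_ge0 ?(ltW N0)// divr_ge0// sqr_ge0.
have path := iterated_step_norm F b k l between.
have steps : `|k%:R - l%:R| <= D.
  have -> : k%:R - l%:R = (excess m0 n k - excess m0 n l) / 2 by rewrite /excess; field.
  rewrite normrM normfV normr_nat.
  have := ler_normB (excess m0 n k) (excess m0 n l).
  have := normr_ge0 (excess m0 n k); rewrite /D; lra.
have {}path := le_trans path (ler_wpM2r b_ge0 steps).
have Db : D * b = (C + kap) * (D ^+ 3 / n%:R ^+ 2 + D / n%:R).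
  by rewrite /b; ring.
have base : 0 <= kap / 4 * (excess m0 n l ^+ 2 / n%:R) <= kap * (D / n%:R).
  apply/andP; split.
    by apply: mulr_ge0; rewrite divr_ge0 ?sqr_ge0 ?(ltW k0) ?(ltW nR).
  have : excess m0 n l ^+ 2 <= 2 ^+ 2.
    by rewrite -[leLHS]real_normK ?num_real// ler_sqr ?nnegrE.
  move=> sq; have : kap / 4 * (excess m0 n l ^+ 2 / n%:R) <= kap / 4 * (4 * (D / n%:R)).
    apply: ler_wpM2l; first by rewrite divr_ge0// ltW.
    by rewrite mulrA ler_pM2r//; lra.
  lra.
have posD : 0 <= kap * (D ^+ 3 / n%:R ^+ 2).
  by rewrite mulr_ge0 ?(ltW k0)// divr_ge0 ?exprn_ge0//; lra.
move: path base posD; rewrite Db /F; clear.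
rewrite !ler_norml => /andP[p1 p2] /andP[q1 q2] r; apply/andP; split; lra.
Qed.

(** The rescaled form of [ln_spin_weight_near]. For [|w| <= B y] the cubic error
is bounded, so passing from the logarithm to the weight preserves its order. *)
Lemma spin_weight_gaussian {R : realType} (beta h m0 s B : R) :
  0 <= beta -> -1 < m0 -> m0 < 1 -> log_odds m0 = 2 * (beta * (m0 + h)) ->
  0 < s -> curvature beta m0 * s ^+ 2 = 2 -> 0 <= B ->
  exists C Y : R, [/\ 0 <= C, 1 <= Y &
    forall (y : R) (n k l : nat), Y <= y -> n%:R = y ^+ 6 ->
    (k <= n)%N -> (l <= n)%N -> `|excess m0 n l| <= 2 ->
    let w := excess m0 n k / (s * y ^+ 3) in
    let A := spin_weight beta h n l in
    `|w| <= B * y ->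
    `|spin_weight beta h n k - A * gauss w|
      <= C * A * gauss w * (1 + `|w| ^+ 3) / y ^+ 3].
Proof.
move=> b0 m1 m2 lo s0 ks B0.
have k0 : 0 < curvature beta m0.
  by rewrite -(pmulr_lgt0 _ (exprn_gt0 2 s0)) ks.
have [C [eps [C0 eps0 near]]] := ln_spin_weight_near beta h m0 b0 m1 m2 lo k0.
set kap := curvature beta m0 in ks k0 near *.
pose C3 := 8 * C * (s + 2) ^+ 3.
have C30 : 0 <= C3 by apply: mulr_ge0; [lra|rewrite exprn_ge0//; lra].
pose q := (s + 2) * (1 + B) / eps.
have q0 : 0 <= q by rewrite /q divr_ge0 ?(ltW eps0)// mulr_ge0//; lra.
exists (C3 * expR (C3 * (1 + B ^+ 3))), (1 + q); split.
- by rewrite mulr_ge0// expR_ge0.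
- by rewrite lerDl.
move=> y n k l Yy ny kn l_n dl w A wB.
have y1 : 1 <= y by clear -Yy q0; lra.
have qy : q <= y by clear -Yy; lra.
have y0 : 0 < y by apply: lt_le_trans y1.
have y30 : 0 < y ^+ 3 by rewrite exprn_gt0.
have n0 : (0 < n)%N by rewrite -(ltr0n R) ny exprn_gt0.
have dk : excess m0 n k = w * (s * y ^+ 3).
  by rewrite /w divfK// gt_eqF// mulr_gt0.
set D := `|excess m0 n k| + 2.
pose v := `|w|.
have v0 : 0 <= v by exact: normr_ge0.
have DE : D <= (s + 2) * (1 + v) * y ^+ 3.
  rewrite /D dk normrM -/v (gtr0_norm (mulr_gt0 s0 y30)).
  have h1 : 0 <= v * y ^+ 3 by rewrite mulr_ge0// ltW.
  have h2 : 1 <= y ^+ 3 by rewrite exprn_ege1.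
  have h3 : 0 <= s * y ^+ 3 by rewrite mulr_ge0// ltW.
  move: h1 h2 h3; clear; lra.
have D0 : 0 <= D by rewrite /D addr_ge0.
have N0 : 0 < n%:R^-1 :> R by rewrite invr_gt0 ltr0n.
have Dn : D / n%:R <= (s + 2) * (1 + v) / y ^+ 3.
  apply: (le_trans (ler_wpM2r (ltW N0) DE)).
  rewrite ny le_eqVlt; apply/orP; left; apply/eqP; field.
  by rewrite gt_eqF.
have sv0 : 0 <= (s + 2) * (1 + v) by apply: mulr_ge0; [clear -s0|clear -v0]; lra.
have D3n : D ^+ 3 / n%:R ^+ 2 <= ((s + 2) * (1 + v)) ^+ 3 / y ^+ 3.
  have D3 : D ^+ 3 <= ((s + 2) * (1 + v) * y ^+ 3) ^+ 3.
    apply: lerXn2r; rewrite ?nnegrE//; apply: mulr_ge0 => //; exact: ltW.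
  apply: (@le_trans _ _ (((s + 2) * (1 + v) * y ^+ 3) ^+ 3 / n%:R ^+ 2)).
    by apply: ler_wpM2r => //; rewrite invr_ge0 exprn_ge0// ler0n.
  rewrite ny le_eqVlt; apply/orP; left; apply/eqP; field.
  by rewrite gt_eqF.
have Deps : D / n%:R <= eps.
  apply: (le_trans Dn); rewrite ler_pdivrMr//.
  have s2 : 0 <= s + 2 by clear -s0; lra.
  have v1 : (s + 2) * (1 + v) <= (s + 2) * ((1 + B) * y).
    apply: ler_wpM2l => //; rewrite mulrDl mul1r.
    exact: lerD.
  apply: (le_trans v1).
  have -> : (s + 2) * ((1 + B) * y) = eps * (q * y).
    by rewrite /q; field; rewrite gt_eqF.
  rewrite ler_pM2l//; apply: (@le_trans _ _ (y * y)).
    by rewrite ler_wpM2r// ltW.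
  by rewrite -expr2 ler_weXn2l.
have cube := cube_sum_le v v0.
pose t := ln (spin_weight beta h n k) - ln A + w ^+ 2 / 2.
have tE : `|t| <= C3 * (1 + v ^+ 3) / y ^+ 3.
  have := near n k l kn l_n n0 dl Deps; rewrite -/A -/D.
  have -> : kap / 4 * (excess m0 n k ^+ 2 / n%:R) = w ^+ 2 / 2.
    rewrite dk ny.
    have -> : kap / 4 * ((w * (s * y ^+ 3)) ^+ 2 / y ^+ 6) = kap * s ^+ 2 / 4 * w ^+ 2.
      by field; rewrite gt_eqF.
    by rewrite ks; field.
  rewrite -/t => /le_trans; apply.
  have Z : (s + 2) * (1 + v) <= ((s + 2) * (1 + v)) ^+ 3.
    rewrite exprS ler_peMr// exprn_ege1//.
    have : 0 <= s * v by rewrite mulr_ge0// ltW.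
    by clear -s0 v0; lra.
  have Zy := ler_wpM2r (ltW (_ : 0 < (y ^+ 3)^-1)) Z.
  have {}Zy : (s + 2) * (1 + v) / y ^+ 3 <= ((s + 2) * (1 + v)) ^+ 3 / y ^+ 3.
    by apply: Zy; rewrite invr_gt0.
  have sum : D ^+ 3 / n%:R ^+ 2 + D / n%:R <= 2 * (((s + 2) * (1 + v)) ^+ 3 / y ^+ 3).
    by move: D3n (le_trans Dn Zy); clear; lra.
  apply: (le_trans (ler_wpM2l C0 sum)).
  rewrite /C3 exprMn.
  have -> : C * (2 * ((s + 2) ^+ 3 * (1 + v) ^+ 3 / y ^+ 3)) =
     2 * C * (s + 2) ^+ 3 / y ^+ 3 * (1 + v) ^+ 3 by ring.
  have -> : 8 * C * (s + 2) ^+ 3 * (1 + v ^+ 3) / y ^+ 3 =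
     2 * C * (s + 2) ^+ 3 / y ^+ 3 * (4 * (1 + v ^+ 3)) by ring.
  apply: ler_wpM2l => //; apply: divr_ge0; last exact: ltW.
  apply: mulr_ge0; first by rewrite mulr_ge0.
  by rewrite exprn_ge0//; clear -s0; lra.
have tB : `|t| <= C3 * (1 + B ^+ 3).
  apply: (le_trans tE); rewrite -mulrA; apply: ler_wpM2l => //.
  rewrite ler_pdivrMr// mulrDl mul1r; apply: lerD; first exact: exprn_ege1.
  by rewrite -exprMn; apply: lerXn2r; rewrite ?nnegrE ?mulr_ge0// ltW.
have A0 : 0 < A by exact: spin_weight_gt0.
have wtE : spin_weight beta h n k = A * gauss w * expR t.
  rewrite /t /gauss -[A in RHS]lnK ?posrE// -!expRD expRK.
  rewrite -[LHS]lnK ?posrE ?spin_weight_gt0//; congr expR; ring.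
have Ag0 : 0 <= A * gauss w by rewrite mulr_ge0 ?ltW// gauss_gt0.
rewrite wtE -[X in _ - X]mulr1 -mulrBr normrM (ger0_norm Ag0).
have e1 : `|expR t - 1| <= C3 * (1 + v ^+ 3) / y ^+ 3 * expR (C3 * (1 + B ^+ 3)).
  apply: (le_trans (expR_sub1_le t)); apply: ler_pM => //.
  by rewrite ler_expR.
apply: (le_trans (ler_wpM2l Ag0 e1)).
rewrite le_eqVlt; apply/orP; left; apply/eqP; rewrite -/v; ring.
Qed.

(** * Tails and normalization of the weights *)

Lemma spin_weight_tail {R : realType} (beta h m0 s C2 c : R) :
  0 <= beta -> -1 < m0 -> m0 < 1 -> log_odds m0 = 2 * (beta * (m0 + h)) ->
  0 < s -> curvature beta m0 * s ^+ 2 = 2 -> 0 <= C2 -> 0 < c ->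
  exists C Y : R, [/\ 0 <= C, 1 <= Y &
    forall (y : R) (n l : nat), Y <= y -> n%:R = y ^+ 6 ->
    dominating_site beta h m0 C2 c n l ->
    let K := spin_weight beta h n l * gaussian_mass R / (2 / (s * y ^+ 3)) in
    forall x : R, 0 <= x -> x <= y ->
    `|\sum_(k < n.+1 | x <= excess m0 n k / (s * y ^+ 3)) spin_weight beta h n k
       - K * (1 - Phi x)|
      <= C * (K * (1 - Phi x)) * (1 + x ^+ 3) / y ^+ 3].
Proof.
move=> b0 m1 m2 lo s0 ks C20 c0.
have s20 : 0 < s ^+ 2 by rewrite exprn_gt0.
have cs0 : 0 < c * s ^+ 2 by rewrite mulr_gt0.
(* [c] bounds the decay in [excess^2 / n], that is [c s^2] in [w^2]; this
   [B] gives [c s^2 B^2 >= 6]. *)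
pose B := 3 + (c * s ^+ 2)^-1.
have B3 : 3 <= B by rewrite /B lerDl invr_ge0 ltW.
have B0 : 0 <= B by apply: le_trans B3.
have cB : 3 / 2 <= c * s ^+ 2 * B ^+ 2.
  have : c * s ^+ 2 * (c * s ^+ 2)^-1 = 1 by rewrite divff// gt_eqF.
  have : 0 < (c * s ^+ 2)^-1 by rewrite invr_gt0.
  rewrite /B; move: cs0; set a := c * _; set b := a^-1; clear.
  move=> a0 b0 ab; have -> : a * (3 + b) ^+ 2 = 9 * a + 6 * (a * b) + a * b * b by ring.
  by rewrite ab; lra.
have [C1 [Y1 [C10 Y11 loc]]] := spin_weight_gaussian beta h m0 s B b0 m1 m2 lo s0 ks B0.
have [C [Y [C0 Y_1 tail]]] := lattice_tail s B C1 C2 (c * s ^+ 2) s0 B3 cB cs0 C10 C20.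
have p0 : 0 < 1 - m0 by rewrite subr_gt0.
have r0 : 0 <= B * s / (1 - m0) by apply: divr_ge0; [apply: mulr_ge0 => //; exact: ltW|exact: ltW].
exists C, (Y + Y1 + B * s / (1 - m0)); split=> //; first by clear -Y_1 Y11 r0; lra.
move=> y n l Yy ny [l_n dl dom] K x x0 xy.
have [yY [yY1 yr]] : Y <= y /\ Y1 <= y /\ B * s / (1 - m0) <= y.
  by clear -Yy Y_1 Y11 r0; repeat split; lra.
have y1 : 1 <= y by apply: le_trans yY1.
have y0 : 0 < y by apply: lt_le_trans y1.
have sy0 : 0 < s * y ^+ 3 by rewrite mulr_gt0// exprn_gt0.
have n0 : (0 < n)%N by rewrite -(ltr0n R) ny exprn_gt0.
have A0 := spin_weight_gt0 beta h n l l_n.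
have wE k : excess m0 n k / (s * y ^+ 3) =
    excess m0 n 0 / (s * y ^+ 3) + k%:R * (2 / (s * y ^+ 3)).
  by rewrite /excess; field; rewrite !gt_eqF.
have w00 : excess m0 n 0 / (s * y ^+ 3) <= 0.
  rewrite ler_pdivrMr// mul0r /excess.
  have : 0 <= n%:R * (1 + m0) by rewrite mulr_ge0//; clear -m1; lra.
  clear; lra.
have wn : B * y <= excess m0 n 0 / (s * y ^+ 3) + n%:R * (2 / (s * y ^+ 3)).
  rewrite -wE ler_pdivlMr//.
  have -> : excess m0 n n = y ^+ 6 * (1 - m0) by rewrite /excess ny; ring.
  have Bs : B * s <= y ^+ 2 * (1 - m0).
    rewrite -ler_pdivrMr//; apply: (le_trans yr).
    by rewrite expr2 ler_peMl// ltW.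
  have := ler_wpM2r (exprn_ge0 4 (ltW y0)) Bs.
  clear; lra.
have sumE : \sum_(k < n.+1 | x <= excess m0 n k / (s * y ^+ 3)) spin_weight beta h n k =
  \sum_(k < n.+1 | x <= excess m0 n 0 / (s * y ^+ 3) + k%:R * (2 / (s * y ^+ 3)))
    spin_weight beta h n k.
  by apply: eq_bigl => k; rewrite -wE.
rewrite sumE; apply: tail => //; first exact: ltW.
- move=> k kn; rewrite -wE => w0 wB.
  have := loc y n k l yY1 ny kn l_n dl; rewrite /= (ger0_norm w0); exact.
- move=> k kn; rewrite -wE => w0; rewrite ltW ?spin_weight_gt0//=.
  apply: (le_trans (dom k kn)).
  suff -> : c * s ^+ 2 * (excess m0 n k / (s * y ^+ 3)) ^+ 2 = c * excess m0 n k ^+ 2 / n%:R by [].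
  by rewrite ny; field; rewrite !gt_eqF.
Qed.

(** Since [Phi 0 = 1/2], the two half-lines, the negative one being seen as
a positive one after the spin flip, contribute [K / 2] each. The possible point
with [excess = 0] is counted twice, and its weight is [O(K / y^3)]. *)
Lemma spin_weight_total {R : realType} (beta h m0 s C2 c : R) :
  0 <= beta -> -1 < m0 -> m0 < 1 -> log_odds m0 = 2 * (beta * (m0 + h)) ->
  0 < s -> curvature beta m0 * s ^+ 2 = 2 -> 0 <= C2 -> 0 < c ->
  exists C Y : R, [/\ 0 <= C, 1 <= Y &
    forall (y : R) (n l : nat), Y <= y -> n%:R = y ^+ 6 ->
    let K := spin_weight beta h n l * gaussian_mass R / (2 / (s * y ^+ 3)) in
    dominating_site beta h m0 C2 c n l ->
    `|\sum_(k < n.+1) spin_weight beta h n k - K| <= C * K / y ^+ 3].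
Proof.
move=> b0 m1 m2 lo s0 ks C20 c0.
have [Ca [Ya [Ca0 Ya1 taila]]] := spin_weight_tail beta h m0 s C2 c b0 m1 m2 lo s0 ks C20 c0.
have [||||Cb [Yb [Cb0 Yb1 tailb]]] :=
  spin_weight_tail beta (- h) (- m0) s C2 c b0 _ _ _ s0 _ C20 c0.
- by rewrite ltrN2.
- by rewrite ltrNl.
- by rewrite /log_odds opprK -opprD !mulrN -lo /log_odds opprB.
- by rewrite /curvature sqrrN.
have M0 := gaussian_mass_gt0 R.
exists (Ca + Cb + C2 * 2 / s / gaussian_mass R), (Ya + Yb); split.
- by rewrite !addr_ge0 ?divr_ge0 ?mulr_ge0// ltW.
- by clear -Ya1 Yb1; lra.
move=> y n l Yy ny K doml.
have [yYa yYb] : Ya <= y /\ Yb <= y by clear -Ya1 Yb1 Yy; split; lra.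
have y1 : 1 <= y by apply: le_trans yYa.
have y0 : 0 < y by apply: lt_le_trans y1.
have y30 : 0 < y ^+ 3 by rewrite exprn_gt0.
have sy0 : 0 < s * y ^+ 3 by rewrite mulr_gt0.
have ta := taila y n l yYa ny doml 0 (lexx 0) (ltW y0).
have tb := tailb y n (n - l)%N yYb ny (dominating_site_flip _ _ _ _ _ _ _ doml) 0 (lexx 0) (ltW y0).
have [l_n dl dom] := doml.
have A0 := spin_weight_gt0 beta h n l l_n.
rewrite spin_weight_flip// in tb.
rewrite -/K Phi0 in ta tb.
have flipE : \sum_(k < n.+1 | 0 <= excess (- m0) n k / (s * y ^+ 3)) spin_weight beta (- h) n k
  = \sum_(k < n.+1 | excess m0 n k <= 0) spin_weight beta h n k.
  rewrite (reindex_inj rev_ord_inj) /=.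
  rewrite (eq_bigr (fun k : 'I_n.+1 => spin_weight beta h n k)); last first.
    by move=> k _; rewrite subSS spin_weight_flip// -ltnS.
  apply: eq_bigl => k.
  have kn : (k <= n)%N by rewrite -ltnS.
  by rewrite subSS excess_flip// pmulr_lge0 ?invr_gt0// oppr_ge0.
have posE : \sum_(k < n.+1 | 0 <= excess m0 n k / (s * y ^+ 3)) spin_weight beta h n k
  = \sum_(k < n.+1 | 0 <= excess m0 n k) spin_weight beta h n k.
  by apply: eq_bigl => k; rewrite pmulr_lge0// invr_gt0.
rewrite flipE in tb; rewrite posE in ta.
pose S0 := \sum_(k < n.+1 | excess m0 n k == 0) spin_weight beta h n k.
have split3 : \sum_(k < n.+1 | 0 <= excess m0 n k) spin_weight beta h n k +
    \sum_(k < n.+1 | excess m0 n k <= 0) spin_weight beta h n k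
  = \sum_(k < n.+1) spin_weight beta h n k + S0.
  rewrite (big_mkcond (fun k : 'I_n.+1 => 0 <= _)) (big_mkcond (fun k : 'I_n.+1 => _ <= 0)).
  rewrite /S0 (big_mkcond (fun k : 'I_n.+1 => _ == 0)) -!big_split/=.
  apply: eq_bigr => k _; case: ltgtP => _; by rewrite ?addr0 ?add0r.
have S0_le : 0 <= S0 <= C2 * spin_weight beta h n l.
  have wk k : (k <= n)%N -> spin_weight beta h n k <= C2 * spin_weight beta h n l.
    move=> kn; apply: (le_trans (dom k kn)).
    rewrite ler_piMr ?mulr_ge0 ?(ltW A0)// expR_le1 oppr_le0.
    by rewrite divr_ge0// mulr_ge0 ?sqr_ge0// ltW.
  apply/andP; split.
    by apply: sumr_ge0 => k _; rewrite ltW// spin_weight_gt0// -ltnS.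
  case: (pickP (fun k : 'I_n.+1 => excess m0 n k == 0)) => [k0 k00|none].
    rewrite /S0 (big_pred1 k0); first by apply: wk; rewrite -ltnS.
    move=> k /=; rewrite -(eqP k00) /excess; apply/eqP/eqP => [E|->//].
    apply/val_inj/eqP; rewrite -(eqr_nat R) /=; apply/eqP; clear -E; lra.
  by rewrite /S0 big_pred0// mulr_ge0// ltW.
have AE : C2 * spin_weight beta h n l = C2 * 2 / s / gaussian_mass R * K / y ^+ 3.
  by rewrite /K; field; rewrite !gt_eqF.
have K0 : 0 <= K.
  by apply: divr_ge0; [apply: mulr_ge0; exact: ltW|apply: divr_ge0 => //; exact: ltW].
have T0 : 0 <= Ca * K / y ^+ 3 by apply: divr_ge0; [exact: mulr_ge0|exact: ltW].
have T1 : 0 <= Cb * K / y ^+ 3 by apply: divr_ge0; [exact: mulr_ge0|exact: ltW].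
rewrite AE in S0_le.
rewrite expr0n/= addr0 mulr1 in ta tb.
move: ta tb split3 S0_le T0 T1; clear.
rewrite !ler_norml => /andP[a1 a2] /andP[b1 b2] e /andP[s1 s2] T0 T1.
apply/andP; split; lra.
Qed.

(** * From configurations to weights *)

Definition up_spins {n : nat} (s : config n) : nat := #|[set i | s i]|.

Lemma sum_over_configs {R : realType} (n : nat) (P : pred nat) (f : nat -> R) :
  \sum_(s : config n | P (up_spins s)) f (up_spins s)
  = \sum_(k < n.+1 | P k) 'C(n, k)%:R * f k.
Proof.
pose toset (s : config n) : {set 'I_n} := [set i | s i].
pose ofset (A : {set 'I_n}) : config n := [ffun i => i \in A].
have toK : cancel toset ofset by move=> s; apply/ffunP => i; rewrite ffunE inE.
have ofK : cancel ofset toset by move=> A; apply/setP => i; rewrite inE ffunE.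
rewrite (reindex ofset); last by exists toset => ? _; [exact: ofK|exact: toK].
have card_le (A : {set 'I_n}) : (#|A| < n.+1)%N.
  by rewrite ltnS -[X in (_ <= X)%N]card_ord max_card.
have upE A : up_spins (ofset A) = #|A| by rewrite /up_spins -[in RHS](ofK A).
rewrite (partition_big (fun A => Ordinal (card_le A)) (fun k : 'I_n.+1 => P k))/=; last first.
  by move=> A; rewrite upE.
apply: eq_bigr => k Pk.
rewrite (eq_bigr (fun=> f k)); last first.
  by move=> A /andP[_ /eqP <-]; rewrite upE.
rewrite sumr_const -[LHS]mulr_natl; congr (_%:R * _).
have := card_draws 'I_n k; rewrite card_ord => <-; rewrite cardsE.
apply: eq_card => A; rewrite !unfold_in /= upE -val_eqE /=.
rewrite -[RHS]/(#|A| == k :> nat).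
by case: eqVneq => [->|_]; rewrite ?Pk ?andbT ?andbF.
Qed.

Lemma total_spinE {R : realType} (n : nat) (s : config n) :
  total_spin R s = 2 * (up_spins s)%:R - n%:R.
Proof.
rewrite /total_spin (eq_bigr (fun i => 2 * (s i)%:R - 1)); last first.
  by move=> i _; rewrite /spin; case: (s i); rewrite /= ?mulr1 ?mulr0 ?sub0r//; ring.
rewrite sumrB -mulr_sumr sumr_const card_ord -natr_sum; congr (2 * _%:R - _).
rewrite /up_spins -sum1_card [RHS]big_mkcond/=; apply: eq_bigr => i _.
by rewrite inE; case: (s i).
Qed.

(** Spins square to [1], hence the [n] on the right-hand side. *)
Lemma pair_sumE {R : realType} (n : nat) (s : config n) :
  2 * (\sum_(i < n) \sum_(j < n | (i < j)%N) spin R s i * spin R s j)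
  = total_spin R s ^+ 2 - n%:R.
Proof.
set T := \sum_(i < n) _.
have T' : T = \sum_(i < n) \sum_(j < n | (j < i)%N) spin R s i * spin R s j.
  rewrite /T (exchange_big_dep predT)//=.
  by apply: eq_bigr => i _; apply: eq_bigr => j _; rewrite mulrC.
have -> : total_spin R s ^+ 2 = T + T + n%:R.
  rewrite {2}T' /T -[X in _ + X%:R]card_ord -sumr_const -!big_split/=.
  rewrite expr2 /total_spin mulr_suml; apply: eq_bigr => i _.
  rewrite mulr_sumr (bigID (fun j : 'I_n => (i < j)%N))/= -addrA; congr (_ + _).
  rewrite (bigD1 i) ?ltnn//= addrC; congr (_ + _).
    apply: eq_bigl => j; rewrite -leqNgt ltn_neqAle andbC.
    by congr (_ && _); rewrite -(inj_eq val_inj).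
  by rewrite /spin; case: (s i); rewrite ?mulr1// mulrNN mulr1.
ring.
Qed.

Lemma CW_weightE {R : realType} (beta h : R) (n : nat) (s : config n) : (0 < n)%N ->
  CW_weight beta h s = expR (- (beta / 2)) *
    expR (beta / (2 * n%:R) * (2 * (up_spins s)%:R - n%:R) ^+ 2
          + beta * h * (2 * (up_spins s)%:R - n%:R)).
Proof.
move=> n0; have nR : n%:R != 0 :> R by rewrite pnatr_eq0 -lt0n.
rewrite /CW_weight -expRD -total_spinE; congr expR.
rewrite -/(total_spin R s) addrA; congr (_ + _).
have E := pair_sumE (R := R) n s; set T := \sum_(i < n) _ in E *.
have -> : T = (total_spin R s ^+ 2 - n%:R) / 2 by rewrite -E; field.
by field.
Qed.

Lemma CW_probE {R : realType} (beta h : R) (n : nat) (P : pred nat) : (0 < n)%N ->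
  CW_prob beta h (fun s : config n => P (up_spins s)) =
  (\sum_(k < n.+1 | P k) spin_weight beta h n k)
  / \sum_(k < n.+1) spin_weight beta h n k.
Proof.
move=> n0.
have sumE (Q : pred nat) : \sum_(s : config n | Q (up_spins s)) CW_weight beta h s =
    expR (- (beta / 2)) * \sum_(k < n.+1 | Q k) spin_weight beta h n k.
  rewrite (eq_bigr _ (fun s _ => CW_weightE beta h n s n0)) -mulr_sumr.
  by rewrite (sum_over_configs n Q (fun k => expR (beta / (2 * n%:R) * (2 * k%:R - n%:R) ^+ 2
          + beta * h * (2 * k%:R - n%:R)))).
rewrite /CW_prob /CW_pmf -mulr_sumr sumE /CW_Z (sumE predT).
by rewrite mulrC invfM mulrACA divff ?mul1r// gt_eqF// expR_gt0.
Qed.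

Lemma Phi_lt1 (R : realType) (x : R) : 0 <= x -> Phi x < 1.
Proof.
move=> x0; rewrite -subr_gt0; have := lt_le_trans (gauss_gt0 x) (gauss_tail_ge R x x0).
rewrite pmulr_rgt0// mulr_gt0 ?gaussian_mass_gt0//; lra.
Qed.

Lemma ratio_error {R : realType} (S T K F a b : R) :
  0 < K -> 0 < F -> b <= 2^-1 ->
  `|S - K * F| <= a * (K * F) -> `|T - K| <= b * K ->
  `|S / T / F - 1| <= 2 * (a + b).
Proof.
move=> K0 F0 b2 SK TK.
have T2 : K / 2 <= T.
  move: TK; rewrite ler_norml => /andP[+ _].
  have : b * K <= 2^-1 * K by rewrite ler_pM2r.
  lra.
have T0 : 0 < T by apply: lt_le_trans T2; rewrite divr_gt0.
have TF0 : 0 < T * F by rewrite mulr_gt0.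
have -> : S / T / F - 1 = (S - T * F) / (T * F) by field; rewrite !gt_eqF.
rewrite normrM normfV (gtr0_norm TF0) ler_pdivrMr//.
have num : `|S - T * F| <= (a + b) * (K * F).
  have -> : S - T * F = (S - K * F) - (T - K) * F by ring.
  apply: (le_trans (ler_normB _ _)); rewrite [`|(T - K) * F|]normrM (gtr0_norm F0).
  have : `|T - K| * F <= b * K * F by rewrite ler_pM2r.
  move: SK; clear; lra.
apply: (le_trans num).
have ab : 0 <= a + b.
  by rewrite -(pmulr_lge0 _ (mulr_gt0 K0 F0)); apply: le_trans num.
rewrite [2 * _]mulrC -mulrA; apply: ler_wpM2l => //.
rewrite mulrA ler_pM2r//; lra.
Qed.

Lemma CW_sqrt_sigma2 {R : realType} (beta m0 y : R) (n : nat) :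
  0 < 1 - m0 ^+ 2 -> 0 < curvature beta m0 -> 0 <= y -> n%:R = y ^+ 6 ->
  Num.sqrt (CW_sigma2 beta m0 n) = Num.sqrt (2 / curvature beta m0) * y ^+ 3.
Proof.
move=> q0 k0 y0 ny.
have kE : curvature beta m0 = 2 * (1 - (1 - m0 ^+ 2) * beta) / (1 - m0 ^+ 2).
  by rewrite /curvature; field; rewrite gt_eqF.
have r0 : 0 < 1 - (1 - m0 ^+ 2) * beta.
  by move: k0; rewrite kE pmulr_lgt0 ?invr_gt0// pmulr_rgt0.
have -> : CW_sigma2 beta m0 n = (2 / curvature beta m0) * (y ^+ 3) ^+ 2.
  by rewrite /CW_sigma2 ny kE; field; rewrite !gt_eqF.
rewrite sqrtrM; last by rewrite divr_ge0// ltW.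
by rewrite sqrtr_sqr ger0_norm// exprn_ge0.
Qed.

Lemma CW_prob_tailE {R : realType} (beta h m0 x y : R) (n : nat) :
  0 < 1 - m0 ^+ 2 -> 0 < curvature beta m0 -> 0 <= y -> n%:R = y ^+ 6 -> (0 < n)%N ->
  CW_prob beta h (fun s : config n => x <= CW_W beta m0 s) =
  (\sum_(k < n.+1 | x <= excess m0 n k / (Num.sqrt (2 / curvature beta m0) * y ^+ 3))
     spin_weight beta h n k) / \sum_(k < n.+1) spin_weight beta h n k.
Proof.
move=> q0 k0 y0 ny n0.
rewrite -(CW_probE beta h n
  (fun k => x <= excess m0 n k / (Num.sqrt (2 / curvature beta m0) * y ^+ 3)))//.
by apply: eq_bigl => s; rewrite /CW_W (CW_sqrt_sigma2 beta m0 y)// total_spinE.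
Qed.

Theorem proposition4p3 (R : realType) (beta h m0 : R)
    (hpar : (0 < beta < 1) \/ (1 <= beta /\ h != 0))
    (hm0 : m0 = tanh (beta * (m0 + h)))
    (hm0h : 0 <= m0 * h) :
  exists (C : R) (O1 : nat -> R -> R),
    forall (n : nat) (x : R),
      (0 < n)%N -> 0 <= x -> x <= n%:R `^ 6^-1 ->
      `|O1 n x| <= C /\
      CW_prob beta h (fun s : config n => x <= CW_W beta m0 s) / (1 - Phi x)
        = 1 + O1 n x * (1 + x ^+ 3) / Num.sqrt n%:R.
Proof.
have b0 : 0 <= beta by case: hpar => [/andP[/ltW//]|[b _]]; lra.
have [m1 m2 lo] := log_odds_tanh (beta * (m0 + h)).
rewrite -hm0 in m1 m2 lo.
have k0 := curvature_gt0 beta h m0 hpar hm0 hm0h.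
have q0 : 0 < 1 - m0 ^+ 2.
  have -> : 1 - m0 ^+ 2 = (1 - m0) * (1 + m0) by ring.
  by rewrite mulr_gt0//; lra.
have v0 : 0 < 2 / curvature beta m0 by rewrite divr_gt0.
set s := Num.sqrt (2 / curvature beta m0).
have s0 : 0 < s by rewrite sqrtr_gt0.
have ks : curvature beta m0 * s ^+ 2 = 2.
  by rewrite sqr_sqrtr ?(ltW v0)// mulrC divfK// gt_eqF.
have [C2 [c [C20 c0 dom]]] := dominating_site_exists beta h m0 hpar hm0 hm0h.
have [Ca [Ya [Ca0 Ya1 tail]]] :=
  spin_weight_tail beta h m0 s C2 c b0 m1 m2 lo s0 ks C20 c0.
have [Cb [Yb [Cb0 Yb1 total]]] :=
  spin_weight_total beta h m0 s C2 c b0 m1 m2 lo s0 ks C20 c0.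
(* The term [2 * Cb] forces the relative error of the normalization below
   [1/2]. *)
pose Y := Ya + Yb + 2 * Cb.
have Y1 : 1 <= Y by rewrite /Y; lra.
have FY : 0 < 1 - Phi Y by rewrite subr_gt0 Phi_lt1//; lra.
pose P n x := CW_prob beta h (fun s : config n => x <= CW_W beta m0 s).
exists (2 * (Ca + Cb) + ((1 - Phi Y)^-1 + 1) * Y ^+ 3),
  (fun n x => (P n x / (1 - Phi x) - 1) * Num.sqrt n%:R / (1 + x ^+ 3)).
move=> n x n0 x0 xn.
have nR : 0 < n%:R :> R by rewrite ltr0n.
pose y : R := n%:R `^ 6^-1.
have ny : n%:R = y ^+ 6.
  by rewrite -powR_mulrn ?powR_ge0// /y -powRrM mulVf ?pnatr_eq0// powRr1// ltW.
have y0 : 0 < y by rewrite powR_gt0.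
have sqrtn : Num.sqrt n%:R = y ^+ 3.
  rewrite ny (_ : y ^+ 6 = (y ^+ 3) ^+ 2); last by rewrite -exprM.
  by rewrite sqrtr_sqr ger0_norm// exprn_ge0// ltW.
have x3 : 0 < 1 + x ^+ 3 by rewrite ltr_wpDr// exprn_ge0.
have y3 : 0 < y ^+ 3 by rewrite exprn_gt0.
have Fx : 0 < 1 - Phi x by rewrite subr_gt0 Phi_lt1.
rewrite /= sqrtn -/(P n x); split; last by field; rewrite !gt_eqF.
rewrite normrM normrM normfV (gtr0_norm y3) (gtr0_norm x3) ler_pdivrMr//.
have small0 : 0 <= ((1 - Phi Y)^-1 + 1) * Y ^+ 3.
  by rewrite mulr_ge0 ?exprn_ge0 ?addr_ge0 ?invr_ge0 ?(ltW FY)//; lra.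
have PE := CW_prob_tailE beta h m0 x y n q0 k0 (ltW y0) ny n0.
rewrite -/(P n x) -/s in PE.
set S := \sum_(k < n.+1 | _) _ in PE; set T := \sum_(k < n.+1) _ in PE.
have Tpos : 0 < T.
  rewrite /T big_ord_recl ltr_pwDl ?spin_weight_gt0//.
  by apply: sumr_ge0 => k _; rewrite ltW// spin_weight_gt0// -ltnS.
have ab0 : 0 <= 2 * (Ca + Cb) by rewrite mulr_ge0// addr_ge0.
have [Yy|yY] := leP Y y.
- have [l doml] := dom n n0.
  have [yYa [yYb yC]] : Ya <= y /\ Yb <= y /\ 2 * Cb <= y.
    by move: Yy; rewrite /Y; clear -Ya1 Yb1 Cb0 => Yy; repeat split; lra.
  have y1 : 1 <= y by exact: le_trans Y1 Yy.
  have tx := tail y n l yYa ny doml x x0 xn.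
  have tot := total y n l yYb ny doml.
  have [l_n _ _] := doml.
  rewrite -/S -/T /= in tx tot.
  set K := _ / (2 / _) in tx tot.
  have K0 : 0 < K.
    rewrite /K; apply: divr_gt0; last by rewrite divr_gt0// mulr_gt0.
    by apply: mulr_gt0; [exact: spin_weight_gt0|exact: gaussian_mass_gt0].
  have bb : Cb / y ^+ 3 <= 2^-1.
    rewrite ler_pdivrMr// mulrC ler_pdivlMr// mulrC.
    by apply: (le_trans yC); rewrite -[leLHS]expr1 ler_weXn2l.
  have a' : `|S - K * (1 - Phi x)| <= Ca * (1 + x ^+ 3) / y ^+ 3 * (K * (1 - Phi x)).
    apply: (le_trans tx); rewrite le_eqVlt; apply/orP; left; apply/eqP; ring.
  have b' : `|T - K| <= Cb / y ^+ 3 * K by rewrite mulrAC.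
  have := ratio_error S T K (1 - Phi x) _ _ K0 Fx bb a' b'.
  rewrite -PE -(ler_pM2r y3) => /le_trans; apply.
  have -> : 2 * (Ca * (1 + x ^+ 3) / y ^+ 3 + Cb / y ^+ 3) * y ^+ 3 =
    2 * Ca * (1 + x ^+ 3) + 2 * Cb by field; rewrite gt_eqF.
  have : 0 <= Cb * x ^+ 3 by rewrite mulr_ge0// exprn_ge0.
  have := mulr_ge0 small0 (ltW x3).
  clear; lra.
(* Small [n]: the probability is at most [1] and [1 - Phi x >= 1 - Phi Y]. *)
- have yY3 : y ^+ 3 <= Y ^+ 3.
    by apply: lerXn2r; rewrite ?nnegrE ?ltW//; apply: lt_trans yY.
  have P01 : 0 <= P n x <= 1.
    rewrite PE divr_ge0 ?(ltW Tpos)//=; last first.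
      by apply: sumr_ge0 => k _; rewrite ltW// spin_weight_gt0// -ltnS.
    rewrite ler_pdivrMr// mul1r /S big_mkcond; apply: ler_sum => k _.
    by case: ifP => _//; rewrite ltW// spin_weight_gt0// -ltnS.
  have FxY : (1 - Phi x)^-1 <= (1 - Phi Y)^-1.
    rewrite lef_pV2 ?posrE// lerD2l lerN2 Phi_nondecreasing//.
    exact: le_trans xn (ltW yY).
  case/andP: P01 => P0 P1.
  have r0 : 0 <= P n x / (1 - Phi x) by rewrite divr_ge0// ltW.
  have r1 : P n x / (1 - Phi x) <= (1 - Phi Y)^-1.
    apply: le_trans FxY; rewrite -[leRHS]mul1r ler_pM2r ?invr_gt0//.
  have bnd : `|P n x / (1 - Phi x) - 1| <= (1 - Phi Y)^-1 + 1.
    by rewrite ler_norml; apply/andP; split; move: r0 r1; clear; lra.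
  apply: (@le_trans _ _ (((1 - Phi Y)^-1 + 1) * Y ^+ 3)).
    by apply: ler_pM => //; exact: ltW.
  apply: (@le_trans _ _ (2 * (Ca + Cb) + ((1 - Phi Y)^-1 + 1) * Y ^+ 3)).
    by rewrite lerDr.
  rewrite ler_peMr ?addr_ge0// lerDl exprn_ge0//.
Qed.
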